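(* Let $v=s_4s_3$. Then the GIT quotient $T\backslash\!\backslash (X^{v}_{w_{3,7}})^{ss}_T(\mathcal{L}(7\omega_3))$ is isomorphic to $\mathbb{P}^1$, and the descent of $\mathcal{L}(7\omega_3)$ to the GIT quotient is $\mathcal{O}(2)$.
   Context: $G=SL(7,\mathbb{C})$, $T$ is the subgroup of diagonal matrices, $B$ (resp. $B^-$) the subgroup of upper (resp. lower) triangular matrices, $s_i=(i,i+1)\in S_7$, and $G_{3,7}$ is the Grassmannian of $3$-dimensional subspaces of $\mathbb{C}^7$. A minimal-length coset representative $w\in S_7$ (one with $w(1)<w(2)<w(3)$ and $w(4)<\dots<w(7)$) is identified with $[w(1),w(2),w(3)]$; e.g. $s_4s_3$ corresponds to $[1,2,5]$. Put $e_w=[e_{w(1)}\wedge e_{w(2)}\wedge e_{w(3)}]$; $X(w)$ is the closure of $Be_w$, $X^v$ the closure of $B^-e_v$, $X^v_w=X(w)\cap X^v$, and $w_{3,7}=[3,5,7]$. $\mathcal{L}(\omega_3)$ is the pullback of $\mathcal{O}(1)$ under the Plücker embedding with its natural $T$-linearization, and $\mathcal{L}(7\omega_3)=\mathcal{L}(\omega_3)^{\otimes7}$. The semistable locus $X^{ss}_T(\mathcal{L})$ is the set of points of $X$ at which some $T$-invariant section over $X$ of a positive power of $\mathcal{L}$ does not vanish, and the GIT quotient is $T\backslash\!\backslash X^{ss}_T(\mathcal{L})=\mathrm{Proj}\bigoplus_{m\ge0}H^0(X,\mathcal{L}^{\otimes m})^T$. The descent of $\mathcal L$ is the line bundle on the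 GIT quotient whose pullback to $X^{ss}_T(\mathcal{L})$ is $T$-equivariantly isomorphic to $\mathcal{L}$. *)

(* Defs.v *)
From mathcomp Require Import all_boot all_order all_fingroup all_algebra.
From mathcomp Require Import boolp classical_sets functions reals.
From mathcomp Require Export complex.
From mathcomp Require Import mpoly.

Set Implicit Arguments.
Unset Strict Implicit.
Unset Printing Implicit Defensive.

Import GRing.Theory.
Local Open Scope classical_set_scope.
Local Open Scope ring_scope.

(* Varieties are taken in the classical sense of Serre's FAC: the closed points,
   the Zariski topology and the sheaf of F-valued regular functions.  A space
   lives on the subset [dom] of an ambient type [pt]; functions, maps and
   sections are total on [pt], but only their values on [dom] matter. *)
Record fspace (F : fieldType) := FSpace {
  pt : Type;
  dom : set pt;
  is_open : set (set pt);
  regular : set pt -> set (pt -> F)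
}.
Arguments pt {F} X : rename.
Arguments dom {F} X _ : rename.
Arguments is_open {F} X _ : rename.
Arguments regular {F} X _ _ : rename.

Section Spaces.
Variable F : fieldType.
Implicit Types X Y : fspace F.

Definition zclosure X (S : set (pt X)) : set (pt X) :=
  [set x | dom X x /\
           forall U, is_open X U -> U x -> exists2 y, U y & S y].

(* Regular functions on U are locally restrictions of regular functions of X;
   for locally closed Z this is the reduced induced structure. *)
Definition subspace X (Z : set (pt X)) : fspace F := {|
  pt := pt X;
  dom := dom X `&` Z;
  is_open := [set U | exists2 W, is_open X W & U = W `&` Z];
  regular := fun U h => forall x, U x -> exists W k,
    [/\ is_open X W, W x, regular X W k &
        forall y, W y -> U y -> h y = k y]
|}.

Definition regular_map X Y (f : pt X -> pt Y) : Prop :=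
  [/\ forall x, dom X x -> dom Y (f x),
      forall W, is_open Y W -> is_open X (dom X `&` f @^-1` W) &
      forall W h, is_open Y W -> regular Y W h ->
        regular X (dom X `&` f @^-1` W) (h \o f)].

Definition biregular X Y (f : pt X -> pt Y) : Prop :=
  regular_map f /\
  exists g : pt Y -> pt X,
    [/\ regular_map g,
        forall x, dom X x -> g (f x) = x &
        forall y, dom Y y -> f (g y) = y].

(* The fibres are subsets of one ambient vector space; every line bundle can be
   put in this form by taking for [amb] the direct sum of its fibres. *)
Record bundle X := Bundle {
  amb : lmodType F;
  fib : pt X -> set amb;
  sec : set (pt X) -> set (pt X -> amb)
}.
Arguments amb {X} L : rename.
Arguments fib {X} L _ _ : rename.
Arguments sec {X} L _ _ : rename.

(* Sections are determined locally, and around every point there is a nowhere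
   zero e such that the sections are the h e with h regular. *)
Definition is_line_bundle X (L : bundle X) : Prop :=
  (forall U s, is_open X U ->
     (sec L U s <-> forall x, U x -> exists W,
        [/\ is_open X W, W `<=` U, W x & sec L W s])) /\
  (forall x, dom X x -> exists U e,
     [/\ is_open X U, U x,
         forall y, U y -> e y <> 0 /\ fib L y = [set c *: e y | c in setT] &
         forall W s, is_open X W -> W `<=` U ->
           (sec L W s <-> exists2 h, regular X W h &
                            forall y, W y -> s y = h y *: e y)]).

(* L is meant to be a line bundle: sections of the pullback are then locally
   multiples h f^*u of one pulled-back section. *)
Definition pullback X Y (f : pt X -> pt Y) (L : bundle Y) : bundle X :=
  @Bundle X (amb L)
    (fun x => fib L (f x))
    (fun U s => forall x, U x -> exists U' W h u,
      [/\ is_open X U' /\ is_open Y W,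
          [/\ U' x, U' `<=` U & forall y, U' y -> W (f y)],
          regular X U' h, sec L W u &
          forall y, U' y -> s y = h y *: u (f y)]).

Definition bundle_iso X (L M : bundle X) (theta : pt X -> amb L -> amb M) :
    Prop :=
  (forall x, dom X x ->
     [/\ forall a e e', fib L x e -> fib L x e' ->
           theta x (a *: e + e') = a *: theta x e + theta x e',
         forall e, fib L x e -> fib M x (theta x e),
         forall e e', fib L x e -> fib L x e' ->
           theta x e = theta x e' -> e = e' &
         forall e', fib M x e' -> exists2 e, fib L x e & theta x e = e']) /\
  (forall U s, is_open X U -> (forall x, U x -> fib L x (s x)) ->
     (sec L U s <-> sec M U (fun x => theta x (s x)))).

(* The elements of T act on X through [actX] and on L through [actL].  The map
   q : X -> Y is T-invariant, and q^*N has the linearization in which T moves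
   the base points only: t sends n in N_(q x) to n in N_(q (t x)). *)
Definition is_descent (G : Type) (T : set G) X Y (q : pt X -> pt Y)
    (actX : G -> pt X -> pt X) (L : bundle X) (actL : G -> amb L -> amb L)
    (N : bundle Y) : Prop :=
  is_line_bundle N /\
  exists2 theta : pt X -> amb (pullback q N) -> amb L,
    bundle_iso theta &
    forall t x n, T t -> dom X x -> fib N (q x) n ->
      theta (actX t x) n = actL t (theta x n).

End Spaces.

Arguments amb {F X} L : rename.
Arguments fib {F X} L _ _ : rename.
Arguments sec {F X} L _ _ : rename.
Arguments zclosure {F} X S _ : rename.
Arguments subspace {F} X Z : rename.
Arguments regular_map {F} X Y f : rename.
Arguments biregular {F} X Y f : rename.
Arguments pullback {F} X Y f L : rename.

Section ProjectiveSpace.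
Variables (F : fieldType) (n : nat).
Local Notation V := 'cV[F]_n.

Definition peval (p : {mpoly F[n]}) (v : V) : F := p.@[fun i => v i 0].

Definition hpoly (d : nat) : set {mpoly F[n]} :=
  [set p | p \is d.-homog for mdeg].

(* Only meaningful for p homogeneous and l a line. *)
Definition nonvanishing (f : V -> F) (l : {vspace V}) : Prop :=
  exists2 v, v \in l & f v <> 0.

(* P(F^n), the space of lines in F^n, hence of dimension n - 1. *)
Definition proj_space : fspace F := {|
  pt := {vspace V};
  dom := [set l | \dim l = 1%N];
  is_open := [set U | forall l, U l -> \dim l = 1%N /\
    exists d p, [/\ hpoly d p, nonvanishing (peval p) l &
      forall l', \dim l' = 1%N -> nonvanishing (peval p) l' -> U l']];
  regular := fun U h => forall l, U l -> exists d a b,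
    [/\ hpoly d a, hpoly d b, nonvanishing (peval b) l &
        forall l' v, U l' -> nonvanishing (peval b) l' ->
          v \in l' -> v <> 0 -> h l' = peval a v / peval b v]
|}.

(* The fibre of O(k) = O(1)^{\otimes k} at the line l is the k-th power of the
   dual of l, that is, the homogeneous functions of degree k on l \ {0}, here
   extended by 0 to the whole of F^n. *)
Definition O_ (k : nat) : bundle proj_space :=
  @Bundle F proj_space (V -> F^o)
    (fun l : {vspace V} => [set g |
      (forall v, ~ (v \in l /\ v <> 0) -> g v = 0) /\
      (forall c v, c <> 0 -> g (c *: v) = c ^+ k * g v)])
    (fun U (s : {vspace V} -> V -> F^o) => forall l, U l ->
      (forall v, ~ (v \in l /\ v <> 0) -> s l v = 0) /\
      exists d a b,
        [/\ hpoly (d + k) a, hpoly d b, nonvanishing (peval b) l &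
          forall l' v, U l' -> nonvanishing (peval b) l' ->
            v \in l' -> v <> 0 -> s l' v = peval a v / peval b v]).

End ProjectiveSpace.

Section Proj.
Variables (F : fieldType) (I : Type).
Local Notation A := (I -> F^o).

(* A graded F-algebra is given by its homogeneous pieces S m inside the
   algebra of all functions I -> F, and a homogeneous ideal P of it by the
   pieces P m.  For homogeneous ideals, primality need only be tested on
   homogeneous elements. *)
Variable S : nat -> set A.

Definition relevant_prime (P : nat -> set A) : Prop :=
  [/\ forall m, P m `<=` S m,
      forall m, P m 0 /\ (forall f g, P m f -> P m g -> P m (f + g)),
      forall k m f g, S k f -> P m g -> P (k + m)%N (f * g),
      forall k m f g, S k f -> S m g -> P (k + m)%N (f * g) -> P k f \/ P m g &
      exists m f, [/\ (0 < m)%N, S m f & ~ P m f]].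

Definition closed_point (P : nat -> set A) : Prop :=
  relevant_prime P /\
  forall Q, relevant_prime Q -> (forall m, P m `<=` Q m) -> Q = P.

(* The value at Q of the fraction a / b of degree 0 is the scalar c with
   a - c b in Q. *)
Definition Proj : fspace F := {|
  pt := nat -> set A;
  dom := closed_point;
  is_open := [set U | forall P, U P -> closed_point P /\
    exists m f, [/\ (0 < m)%N, S m f, ~ P m f &
      forall Q, closed_point Q -> ~ Q m f -> U Q]];
  regular := fun U h => forall P, U P -> exists m a b,
    [/\ S m a, S m b, ~ P m b &
      forall Q, U Q -> ~ Q m b -> Q m (a - h Q *: b)]
|}.

End Proj.

(* The torus T acts on P(F^n) through the representation rho. *)
Section GIT.
Variables (F : fieldType) (d n : nat).
Variables (T : set 'M[F]_d) (rho : 'M[F]_d -> 'M[F]_n).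
Variable X : set {vspace 'cV[F]_n}.
Local Notation V := 'cV[F]_n.

Definition act_line (g : 'M[F]_d) (l : {vspace V}) : {vspace V} :=
  (linfun (mulmx (rho g)) @: l)%VS.

(* The natural linearization of O(k): (g u)(v) = u(g^-1 v). *)
Definition act_fib (g : 'M[F]_d) (u : V -> F^o) : V -> F^o :=
  fun v => u (rho (invmx g) *m v).

Definition var : fspace F := subspace (proj_space F n) X.

(* O(k) restricted to a subset Z of P(F^n). *)
Definition O_on (Z : set {vspace V}) (k : nat) :
    bundle (subspace (proj_space F n) Z) :=
  pullback (subspace (proj_space F n) Z) (proj_space F n)
    (fun l : {vspace V} => l) (O_ F n k).

(* H^0(X, O(k))^T.  An invariant section s is encoded by the function
   v |-> s_<v>(v) on the cone over X minus 0, extended by 0, so that the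
   product of sections is the product of functions. *)
Definition inv_sections (k : nat) : set (V -> F^o) :=
  [set f | exists s : {vspace V} -> V -> F^o,
    [/\ sec (O_on X k) (dom var) s,
        forall t l, T t -> dom var l -> s (act_line t l) = act_fib t (s l),
        forall v, dom var <[v]>%VS -> f v = s <[v]>%VS v &
        forall v, ~ dom var <[v]>%VS -> f v = 0]].

(* Below the polarization is L = O(k) on X, so that L^{\otimes m} = O(m k). *)
Definition inv_ring (k m : nat) : set (V -> F^o) := inv_sections (m * k).

Definition semistable (k : nat) : set {vspace V} :=
  [set l | dom var l /\
     exists m f, [/\ (0 < m)%N, inv_ring k m f & nonvanishing f l]].

Definition ss_locus (k : nat) : fspace F :=
  subspace (proj_space F n) (semistable k).

Definition GIT_quotient (k : nat) : fspace F := Proj (inv_ring k).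

(* x is sent to the ideal of the invariants vanishing at x. *)
Definition quotient_map (k : nat) :
    pt (ss_locus k) -> pt (GIT_quotient k) :=
  fun (l : {vspace V}) m => [set f | inv_ring k m f /\ ~ nonvanishing f l].

Definition is_GIT_descent (k : nat) (N : bundle (GIT_quotient k)) : Prop :=
  @is_descent F 'M[F]_d T (ss_locus k) (GIT_quotient k)
    (@quotient_map k) act_line (O_on (semistable k) k) act_fib N.

End GIT.

Arguments is_GIT_descent {F d n} T rho X k N : rename.

Section Grassmannian.
Variables (F : fieldType) (r n : nat).

(* The index set of the Plücker coordinates: i_1 < ... < i_r. *)
Definition pidx := {t : r.-tuple 'I_n | sorted ltn (map val t)}.

Definition pcoord (k : 'I_#|{: pidx}|) (i : 'I_r) : 'I_n :=
  tnth (val (enum_val k)) i.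

Local Notation Lam := 'cV[F]_#|{: pidx}|.

(* The vector a_1 ^ ... ^ a_r of \Lambda^r F^n, for the columns a_j of A, in
   the basis of the e_(i_1) ^ ... ^ e_(i_r) with i_1 < ... < i_r. *)
Definition wedge (A : 'M[F]_(n, r)) : Lam :=
  \col_k \det (\matrix_(i, j) A (pcoord k i) j).

(* The matrix of \Lambda^r g in the same basis. *)
Definition ext_power (g : 'M[F]_n) : 'M[F]_#|{: pidx}| :=
  \matrix_(k, l) \det (\matrix_(i, j) g (pcoord k i) (pcoord l j)).

(* G_{r,n}, identified with its image under the Plücker embedding. *)
Definition Gr : fspace F := subspace (proj_space F #|{: pidx}|)
  [set <[wedge A]>%VS | A in [set A : 'M[F]_(n, r) | \rank A = r]].

Definition SL : set 'M[F]_n := [set g | \det g = 1].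
Definition torus : set 'M[F]_n := [set g | SL g /\ is_diag_mx g].
(* [is_trig_mx] means lower triangular. *)
Definition Bminus : set 'M[F]_n := [set g | SL g /\ is_trig_mx g].
Definition Bplus : set 'M[F]_n := [set g | SL g /\ is_trig_mx g^T].

Definition e_ (a : r.-tuple 'I_n) : {vspace Lam} :=
  <[wedge (\matrix_(i, j) (i == tnth a j)%:R)]>%VS.

Definition Horbit (H : set 'M[F]_n) (x : {vspace Lam}) : set {vspace Lam} :=
  [set act_line ext_power g x | g in H].

Definition schubert (w : r.-tuple 'I_n) : set {vspace Lam} :=
  zclosure Gr (Horbit Bplus (e_ w)).

Definition opposite_schubert (v : r.-tuple 'I_n) : set {vspace Lam} :=
  zclosure Gr (Horbit Bminus (e_ v)).

Definition richardson (v w : r.-tuple 'I_n) : set {vspace Lam} :=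
  schubert w `&` opposite_schubert v.

End Grassmannian.

Arguments torus F n _ : clear implicits.
Arguments richardson F {r n} v w _ : rename.
Arguments ext_power {F} r {n} g : rename.

(* 'I_7 counts from 0, so that k : 'I_7 stands for k + 1. *)
Definition simple_refl (i : nat) : 'S_7 := tperm (inord i.-1) (inord i).

Definition coset_rep (w : 'S_7) : 3.-tuple 'I_7 :=
  [tuple w (inord 0); w (inord 1); w (inord 2)].

(* s_4 s_3; the product of permutations in fingroup is (s * t) x = t (s x). *)
Definition s4s3 : 'S_7 := (simple_refl 3 * simple_refl 4)%g.

(* [3,5,7] *)
Definition w37 : 3.-tuple 'I_7 := [tuple inord 2; inord 4; inord 6].

(* Main.v *)
Require Import Defs.
From mathcomp Require Import all_boot fingroup perm all_algebra.
From mathcomp Require Import boolp classical_sets functions reals.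
From mathcomp Require Import mpoly ring.

(** The vector space spanned by a general point of the Richardson variety X has
a basis a, b, c with a supported on rows 1-3, b on rows 2-5 and c on rows 5-7.
Rescaling these three vectors and acting by the torus on the rows, one can make
all their entries equal to 1 except the entries v0 and v1 of b in rows 2 and 3.
What remains is a slice with coordinates (v0, v1), on which the leftover
symmetry is the scaling of v (slice_orbit, slice_scale). Thus the quotient
should be the projective line with coordinates v0 and v1.

To make this precise, an invariant section of O(7m) on X is restricted to the
slice. It becomes a binary form of degree 2m: homogeneity comes from
slice_scale, and the restriction is polynomial because a regular function on a
line is a polynomial (local_polyfun, inv_form). The restriction determines the
section, because the torus translates of the slice are dense in X (density,
inv_cut). Density has a geometric content, since X is given as an intersection
of two orbit closures: the Pluecker coordinates vanishing on it provide vectors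
in rows 1-3 and in rows 5-7 of the space, and explicit one-parameter
deformations bring any point into general position. Conversely three monomials
F00, F01, F11 of degree 7 in the Pluecker coordinates are invariant and
restrict to v0^2, v0 v1 and v1^2. So the ring of invariants is the second
Veronese ring of the projective line (inv_veronese).

The closed points of Proj of that ring are the ideals of points of the
projective line: over an algebraically closed field a form is a product of
linear forms, so that a nonzero relevant prime contains the square of a linear
form, and this determines it (binary_factor, has_sqr_pid, closed_pointE,
pointP_biregular).

As to the descent, a section of O(2) on the projective line is locally a
multiple of v0^2 or v1^2, and these correspond to the frames F00 and F11 of
O(7) on the semistable locus, where F00 and F11 have no common zero
(semistable_charts). The map theta that matches the frames is invariant, and
matching frames is enough for an isomorphism of line bundles (frames_iso,
theta_iso). *)

Set Implicit Arguments.
Unset Strict Implicit.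
Unset Printing Implicit Defensive.

Import GRing.Theory.
Local Open Scope classical_set_scope.
Local Open Scope ring_scope.

(** * Homogeneous polynomials and lines *)

Section HomogeneousPolynomials.
Variables (F : fieldType) (n : nat).
Implicit Types (p q : {mpoly F[n]}) (v : 'cV[F]_n) (l : {vspace 'cV[F]_n}).

Lemma pevalM p q v : peval (p * q) v = peval p v * peval q v.
Proof. exact: mevalM. Qed.

Lemma pevalD p q v : peval (p + q) v = peval p v + peval q v.
Proof. exact: mevalD. Qed.

Lemma pevalZ c p v : peval (c *: p) v = c * peval p v.
Proof. exact: mevalZ. Qed.

Lemma pevalC c v : peval (c%:MP : {mpoly F[n]}) v = c.
Proof. exact: mevalC. Qed.

Lemma pevalXU i v : peval ('X_i : {mpoly F[n]}) v = v i 0.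
Proof. exact: mevalXU. Qed.

Lemma pevalXn p k v : peval (p ^+ k) v = peval p v ^+ k.
Proof. by elim: k => [|k IH]; rewrite ?pevalC // !exprS pevalM IH. Qed.

Lemma peval_sum (I : Type) (r : seq I) (E : I -> {mpoly F[n]}) v :
  peval (\sum_(i <- r) E i) v = \sum_(i <- r) peval (E i) v.
Proof. by rewrite /peval raddf_sum. Qed.

Lemma peval_scale d p c v :
  hpoly d p -> peval p (c *: v) = c ^+ d * peval p v.
Proof.
move=> hp; rewrite /peval !mevalE mulr_sumr; apply: eq_big_seq => m mp.
rewrite mulrCA; congr (_ * _).
rewrite -(dhomog_mf hp mp) /= mdegE -prodrXr -big_split /=.
by apply: eq_bigr => i _; rewrite mxE exprMn.
Qed.

Lemma hpolyM d e p q : hpoly d p -> hpoly e q -> hpoly (d + e) (p * q).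
Proof. exact: dhomogM. Qed.

Lemma hpolyD d p q : hpoly d p -> hpoly d q -> hpoly d (p + q).
Proof. exact: rpredD. Qed.

Lemma hpolyZ d c p : hpoly d p -> hpoly d (c *: p).
Proof. exact: rpredZ. Qed.

Lemma hpoly0 d : hpoly d (0 : {mpoly F[n]}).
Proof. exact: rpred0. Qed.

Lemma hpolyC c : hpoly 0 (c%:MP : {mpoly F[n]}).
Proof.
by rewrite -[c%:MP]alg_mpolyC; apply: hpolyZ; apply: dhomog1.
Qed.

Lemma hpolyXU i : hpoly 1 ('X_i : {mpoly F[n]}).
Proof. by rewrite /hpoly /= dhomogX /= mdeg1. Qed.

Lemma hpolyXn d k p : hpoly d p -> hpoly (d * k) (p ^+ k).
Proof. exact: dhomogMn. Qed.

Lemma dim1_line l : \dim l = 1%N -> exists2 v, v != 0 & l = <[v]>%VS.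
Proof.
move=> dl; exists (vpick l); first by rewrite vpick0 -dimv_eq0 dl.
apply/eqP; rewrite eq_sym eqEdim -memvE memv_pick dl dim_vline.
by rewrite vpick0 -dimv_eq0 dl.
Qed.

Lemma line_mem l u v : \dim l = 1%N -> u \in l -> u != 0 -> v \in l ->
  exists c, v = c *: u.
Proof.
move=> dl ul u0 vl; suff: v \in <[u]>%VS by move=> /vlineP.
suff -> : <[u]>%VS = l by [].
by apply/eqP; rewrite eqEdim -memvE ul dl dim_vline u0.
Qed.

Lemma line_ext l u : \dim l = 1%N -> u \in l -> u != 0 -> l = <[u]>%VS.
Proof.
move=> dl ul u0; apply/eqP.
by rewrite eq_sym eqEdim -memvE ul dl dim_vline u0.
Qed.

Lemma dim_line v : v != 0 -> \dim <[v]> = 1%N.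
Proof. by rewrite dim_vline => ->. Qed.

Lemma nonvanishing_at d p l v : hpoly d p -> \dim l = 1%N ->
  v \in l -> v != 0 -> (nonvanishing (peval p) l <-> peval p v <> 0).
Proof.
move=> hp dl vl v0; split=> [[u ul] pu|]; last by exists v.
have [c uE] := line_mem dl vl v0 ul.
by move=> pv; apply: pu; rewrite uE (peval_scale _ _ hp) pv mulr0.
Qed.

Lemma nonvanishing_line d p v : hpoly d p -> v != 0 ->
  (nonvanishing (peval p) <[v]>%VS <-> peval p v <> 0).
Proof.
by move=> hp v0; apply: (nonvanishing_at hp); rewrite ?dim_line ?memv_line.
Qed.

Lemma nonvanishing1 l : \dim l = 1%N ->
  nonvanishing (peval (1%:MP : {mpoly F[n]})) l.
Proof.
move=> dl; have [v v0 ->] := dim1_line dl.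
by apply/(nonvanishing_line (hpolyC 1) v0); rewrite pevalC; apply/eqP/oner_neq0.
Qed.

Lemma nonvanishingM d e p q l : hpoly d p -> hpoly e q -> \dim l = 1%N ->
  (nonvanishing (peval (p * q)) l <->
   nonvanishing (peval p) l /\ nonvanishing (peval q) l).
Proof.
move=> hp hq dl; have [v v0 lE] := dim1_line dl.
rewrite lE (nonvanishing_line hp v0) (nonvanishing_line hq v0).
rewrite (nonvanishing_line (hpolyM hp hq) v0) pevalM.
split=> [pq|[/eqP p0 /eqP q0]]; last by apply/eqP; rewrite mulf_neq0.
by split=> z; apply: pq; rewrite z ?mul0r ?mulr0.
Qed.

End HomogeneousPolynomials.

(** * Spaces with functions *)

(** What local frames of line bundles need in order to be restricted, pulled
    back and compared. The projective spaces, their subspaces and Proj of a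
    Veronese ring all have these properties. *)
Record ringed (F : fieldType) (X : fspace F) : Prop := Ringed {
  open_dom : forall U x, is_open X U -> U x -> dom X x;
  openI : forall U W, is_open X U -> is_open X W -> is_open X (U `&` W);
  regular_res : forall U W h, W `<=` U -> regular X U h -> regular X W h;
  regular_glue : forall U h, is_open X U ->
    (forall x, U x -> exists W k, [/\ is_open X W, W x, regular X W k &
        forall y, W y -> U y -> h y = k y]) ->
    regular X U h;
  regular1 : forall U, is_open X U -> regular X U (fun=> 1);
  regularM : forall U h k, is_open X U -> regular X U h -> regular X U k ->
    regular X U (fun x => h x * k x)
}.

Lemma mulff_div (F : fieldType) (a b e : F) :
  e <> 0 -> (a * e) / (b * e) = a / b.
Proof. by move=> /eqP e0; rewrite -mulf_div divff // mulr1. Qed.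

Lemma proj_space_ringed (F : fieldType) n : ringed (proj_space F n).
Proof.
split=> /=.
- by move=> U l hU /hU[].
- move=> U W hU hW l [Ul Wl]; have [dl [d [p [hp pl pU]]]] := hU _ Ul.
  have [_ [e [q [hq ql qW]]]] := hW _ Wl.
  split=> //; exists (d + e)%N, (p * q); split; first exact: hpolyM.
    by apply/(nonvanishingM hp hq dl).
  move=> l' dl' /(nonvanishingM hp hq dl')[pl' ql'].
  by split; [apply: pU|apply: qW].
- move=> U W h WU hU l /WU /hU[d [a [b [ha hb bl ab]]]].
  by exists d, a, b; split=> // l' v /WU; apply: ab.
- move=> U h oU hU l Ul; have [W [k [oW Wl rk hk]]] := hU l Ul.
  have [d [a [b [ha hb bl ab]]]] := rk _ Wl.
  have [dl [e [q [hq ql qW]]]] := oW _ Wl.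
  exists (d + e)%N, (a * q), (b * q); split; [exact: hpolyM|exact: hpolyM| |].
    by apply/(nonvanishingM hb hq dl).
  move=> l' v Ul' bql' vl' v0.
  have dl' : \dim l' = 1%N by case: (oU _ Ul').
  have /(nonvanishingM hb hq dl')[nb nq] := bql'.
  have Wl' : W l' by apply: qW.
  rewrite hk // (ab l' v) // !pevalM mulff_div //.
  by move/eqP: v0 => v0; apply/(nonvanishing_at hq dl' vl' v0).
- move=> U oU l Ul; exists 0%N, 1%:MP, 1%:MP; split; try exact: hpolyC.
    by have [dl _] := oU _ Ul; apply: nonvanishing1.
  by move=> l' v _ _ _ _; rewrite pevalC divr1.
- move=> U h k oU hU kU l Ul.
  have [d [a [b [ha hb bl ab]]]] := hU l Ul.
  have [d' [a' [b' [ha' hb' bl' ab']]]] := kU l Ul.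
  exists (d + d')%N, (a * a'), (b * b'); split; try exact: hpolyM.
    by have [dl _] := oU _ Ul; apply/(nonvanishingM hb hb' dl).
  move=> l' v Ul' bbl' vl' v0.
  have [dl' _] := oU _ Ul'.
  have /(nonvanishingM hb hb' dl')[nb nb'] := bbl'.
  by rewrite (ab l' v) // (ab' l' v) // !pevalM mulf_div.
Qed.

Lemma subspace_ringed (F : fieldType) (X : fspace F) Z :
  ringed X -> ringed (subspace X Z).
Proof.
move=> rX; split=> /=.
- by move=> _ x [W oW ->] [Wx Zx]; split=> //; apply: (open_dom rX oW).
- move=> _ _ [W oW ->] [W' oW' ->]; exists (W `&` W'); first exact: openI.
  by rewrite setIACA setIid.
- move=> U W h WU hU x /WU /hU[V [k [oV Vx rk hk]]].
  by exists V, k; split=> // y Vy /WU; apply: hk.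
- move=> _ h [U oU ->] hU x Ux.
  have [W [k [[V oV ->] [Vx Zx] rk hk]]] := hU x Ux.
  have [V' [k' [oV' V'x rk' hk']]] := rk x (conj Vx Zx).
  exists (V `&` V'), k'; split=> //; first exact: openI.
    by apply: (regular_res rX _ rk') => y [].
  by move=> y [Vy V'y] [Uy Zy]; rewrite hk ?hk'.
- move=> _ [U oU ->] x [Ux Zx]; exists U, (fun=> 1); split=> //.
  exact: regular1.
- move=> U h k _ hU kU x Ux.
  have [V [h' [oV Vx rh hh]]] := hU x Ux.
  have [V' [k' [oV' V'x rk hk]]] := kU x Ux.
  exists (V `&` V'), (fun y => h' y * k' y); split=> //; first exact: openI.
    apply: regularM => //; first exact: openI.
      by apply: (regular_res rX _ rh) => y [].
    by apply: (regular_res rX _ rk) => y [].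
  by move=> y [Vy V'y] Uy; rewrite hh ?hk.
Qed.

(** * Line bundles and local frames *)

Section Frames.
Variables (F : fieldType).

Definition frame (X : fspace F) (L : bundle X) (U : set (pt X))
    (e : pt X -> amb L) : Prop :=
  [/\ is_open X U,
      forall y, U y -> e y <> 0 /\ fib L y = [set c *: e y | c in setT] &
      forall W s, is_open X W -> W `<=` U ->
        (sec L W s <-> exists2 h, regular X W h &
                         forall y, W y -> s y = h y *: e y)].

Definition sec_local (X : fspace F) (L : bundle X) : Prop :=
  forall U s, is_open X U ->
    (forall x, U x -> exists W,
       [/\ is_open X W, W `<=` U, W x & sec L W s]) -> sec L U s.

Definition sec_res (X : fspace F) (L : bundle X) : Prop :=
  forall U W s, is_open X W -> W `<=` U -> sec L U s -> sec L W s.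

Lemma line_bundle_frames (X : fspace F) (L : bundle X) :
  sec_local L ->
  (forall x, dom X x -> exists U e, U x /\ frame (L := L) U e) ->
  is_line_bundle L.
Proof.
move=> lL fL; split=> [U s oU|x /fL[U [e [Ux [oU eU sU]]]]].
  by split=> [sU x Ux|]; [exists U; split|exact: lL].
by exists U, e.
Qed.

Lemma scaler_injl (V : lmodType F) (u : V) (c d : F) :
  u <> 0 -> c *: u = d *: u -> c = d.
Proof.
move=> /eqP u0 /eqP; rewrite -subr_eq0 -scalerBl scaler_eq0 (negbTE u0) orbF.
by rewrite subr_eq0 => /eqP.
Qed.

Lemma pullback_local (X Y : fspace F) f (L : bundle Y) :
  sec_local (pullback X Y f L).
Proof.
move=> U s _ hU x /hU[W [oW WU Wx sW]].
have [V [W' [h [u [[oV oW'] [Vx VW VW'] rh su hs]]]]] := sW x Wx.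
by exists V, W', h, u; split=> //; split=> // y /VW /WU.
Qed.

Lemma pullback_res (X Y : fspace F) f (L : bundle Y) :
  ringed X -> sec_res (pullback X Y f L).
Proof.
move=> rX U W s oW WU sU x Wx.
have [V [W' [h [u [[oV oW'] [Vx VU VW'] rh su hs]]]]] := sU x (WU x Wx).
exists (V `&` W), W', h, u; split=> //.
- by split=> //; apply: openI.
- by split=> // y [] // /VW'.
- by apply: (regular_res rX _ rh) => y [].
- by move=> y [Vy _]; apply: hs.
Qed.

(** A local section of the pullback is locally h times the pullback of a
    multiple of the frame, and the coefficients agree because the frame has no
    zero; they glue to one regular function. *)
Lemma frame_pullback (X Y : fspace F) f (L : bundle Y) U e :
  ringed X -> ringed Y -> sec_res L -> regular_map X Y f ->
  frame (L := L) U e ->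
  frame (L := pullback X Y f L) (dom X `&` f @^-1` U) (e \o f).
Proof.
move=> rX rY rL [fd fo fr] [oU eU sU]; split=> [|y [_ Ufy]|W s oW WU].
- exact: fo.
- exact: eU.
split=> [sW|[h rh hs] x Wx]; last first.
  exists W, U, h, e; split=> //.
    by split=> // y /WU[].
  by apply/(sU _ _ oU) => //; exists (fun=> 1) => [|y _];
    rewrite ?scale1r //; apply: regular1.
have key x : W x -> exists V k, [/\ is_open X V, V x, V `<=` W,
    regular X V k & forall y, V y -> s y = k y *: e (f y)].
  move=> Wx; have [dx Ufx] := WU _ Wx.
  have [V [W' [h [u [[oV oW'] [Vx VW VW'] rh su hs]]]]] := sW x Wx.
  have oW'U : is_open Y (W' `&` U) by apply: openI.
  have [|k rk ku] := (sU (W' `&` U) u oW'U (@subIsetr _ _ _)).1.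
    by apply: (rL _ _ _ _ _ su) => // y [].
  exists (V `&` (dom X `&` f @^-1` (W' `&` U))), (fun y => h y * k (f y)).
  split.
  - by apply: openI => //; apply: fo.
  - by do 3!split=> //; apply: VW'.
  - by move=> y [/VW].
  - apply: regularM => //; first by apply: openI => //; apply: fo.
      by apply: (regular_res rX _ rh) => y [].
    by apply: (regular_res rX _ (fr _ _ oW'U rk)) => y [].
  by move=> y [Vy [_ /= Wfy]]; rewrite hs // ku // scalerA.
pose H y := xget 0 [set c | s y = c *: e (f y)].
have HE y c : W y -> s y = c *: e (f y) -> H y = c.
  move=> Wy sc; have [_ Ufy] := WU _ Wy; have [e0 _] := eU _ Ufy.
  apply: (scaler_injl e0); rewrite -sc.
  by have /= := @xgetPex _ 0 [set c | s y = c *: e (f y)] (ex_intro _ c sc).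
exists H.
  apply: regular_glue => // x Wx; have [V [k [oV Vx VW rk ks]]] := key x Wx.
  by exists V, k; split=> // y Vy Wy; apply: HE => //; apply: ks.
move=> y Wy; have [V [k [oV Vx VW rk ks]]] := key y Wy.
by rewrite (HE y (k y)) //; apply: ks.
Qed.

(** In a pair of local frames that correspond under theta, a section and its
    image have the same coefficient, so that one is regular when the other is.
    *)
Lemma frames_iso (X : fspace F) (L M : bundle X)
    (theta : pt X -> amb L -> amb M) :
  ringed X -> sec_local L -> sec_res L -> sec_local M -> sec_res M ->
  (forall x, dom X x -> exists U e f,
     [/\ U x, frame (L := L) U e, frame (L := M) U f &
         forall y c, U y -> theta y (c *: e y) = c *: f y]) ->
  bundle_iso theta.
Proof.
move=> rX lL sL lM sM fr; split=> [x dx|U s oU sf].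
  have [U [e [f [Ux [_ eU _] [_ fU _] ef]]]] := fr x dx.
  have [e0 fibL] := eU _ Ux; have [f0 fibM] := fU _ Ux.
  rewrite fibL fibM; split.
  - move=> a _ _ [c _ <-] [d _ <-].
    by rewrite scalerA -scalerDl !ef // scalerDl scalerA.
  - by move=> _ [c _ <-]; rewrite ef //; exists c.
  - move=> _ _ [c _ <-] [d _ <-]; rewrite !ef //.
    by move=> /(scaler_injl f0) ->.
  - by move=> _ [c _ <-]; exists (c *: e x); [exists c|rewrite ef].
split=> sU; [apply: lM|apply: lL] => // x Ux;
  have [V [e [f [Vx [oV eV seV] [_ fV sfV] ef]]]] :=
    fr x (open_dom rX oU Ux);
  have oUV := openI rX oU oV; exists (U `&` V); split=> //;
  try by move=> y [].
- have [h rh hs] := (seV _ s oUV (@subIsetr _ _ _)).1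
    (sL _ _ _ oUV (@subIsetl _ _ _) sU).
  by apply/(sfV _ _ oUV (@subIsetr _ _ _)); exists h => // y UVy;
    rewrite hs // ef //; case: UVy.
- have [h rh hs] := (sfV _ _ oUV (@subIsetr _ _ _)).1
    (sM _ _ _ oUV (@subIsetl _ _ _) sU).
  apply/(seV _ _ oUV (@subIsetr _ _ _)); exists h => // y UVy.
  have [Uy Vy] := UVy; have [f0 _] := fV _ Vy.
  have := sf y Uy; have [_ ->] := eV _ Vy; move=> [c _ cE].
  have := hs y UVy; rewrite -cE ef // => /(scaler_injl f0) -> //.
Qed.

End Frames.

(** * The bundles O(k) *)

Section TwistedBundles.
Variables (F : fieldType) (n : nat).

Definition psec (p : {mpoly F[n]}) (l : {vspace 'cV[F]_n}) : 'cV[F]_n -> F^o :=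
  fun v => if (v \in l) && (v != 0) then peval p v else 0.

Definition pdomain (p : {mpoly F[n]}) : set {vspace 'cV[F]_n} :=
  [set l | \dim l = 1%N /\ nonvanishing (peval p) l].

Lemma pdomain_open k p : hpoly k p -> is_open (proj_space F n) (pdomain p).
Proof. by move=> hp l [dl pl]; split=> //; exists k, p. Qed.

Lemma O_res k : sec_res (O_ F n k).
Proof.
move=> U W s _ WU sU l /WU /sU[s0 [d [a [b [ha hb bl ab]]]]].
by split=> //; exists d, a, b; split=> // l' v /WU; apply: ab.
Qed.

Lemma line_mem_neq0 (l : {vspace 'cV[F]_n}) u v :
  \dim l = 1%N -> u \in l -> u != 0 -> v \in l -> v != 0 ->
  exists2 c, c != 0 & v = c *: u.
Proof.
move=> dl ul u0 vl v0; have [c vE] := line_mem dl ul u0 vl; exists c => //.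
by apply: contraNneq v0 => c0; rewrite vE c0 scale0r.
Qed.

(** The coefficient of a section s is s / p: if s is locally a / b, it is a / (b
    p), a quotient of two polynomials of the same degree. *)
Lemma O_frame k p : hpoly k p -> frame (L := O_ F n k) (pdomain p) (psec p).
Proof.
move=> hp; split; first exact: pdomain_open hp.
- move=> l [dl pl]; have [u u0 lE] := dim1_line dl.
  have ul : u \in l by rewrite lE memv_line.
  have /(nonvanishing_at hp dl ul u0) pu := pl.
  split.
    by move=> /(congr1 (@^~ u)); rewrite /psec ul u0.
  apply/seteqP; split=> [g [g0 gh]|_ [c _ <-]] /=; last first.
    split=> [v nv|a v a0].
      change (c * psec p l v = 0); rewrite /psec.
      case: ifP; last by rewrite mulr0.
      by move=> /andP[vl /eqP v0]; case: nv.
    change (c * psec p l (a *: v) = a ^+ k * (c * psec p l v)).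
    rewrite /psec rpredZeq scaler_eq0 /=.
    have -> : (a == 0) = false by apply/eqP.
    case: ifP => _; last by rewrite !mulr0.
    by rewrite (peval_scale _ _ hp) mulrCA.
  exists (g u / peval p u) => //; apply: funext => v.
  change (g u / peval p u * psec p l v = g v).
  rewrite /psec; case: ifP => [/andP[vl v0]|/negbT vn]; last first.
    rewrite mulr0 g0 //.
    by move=> [vl /eqP v0]; rewrite vl v0 in vn.
  have [c c0 ->] := line_mem_neq0 dl ul u0 vl v0.
  rewrite gh; last exact/eqP.
  rewrite (peval_scale _ _ hp).
  by rewrite mulrCA divfK //; apply/eqP.
move=> W s oW WU; split=> [sW|[h rh hs] l Wl].
  pose h (l : {vspace 'cV[F]_n}) := s l (vpick l) / peval p (vpick l).
  have key l v : W l -> v \in l -> v != 0 -> peval p v != 0 /\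
      h l = s l v / peval p v.
    move=> Wl vl v0; have [dl pl] := WU _ Wl.
    have ul := memv_pick l; have u0 : vpick l != 0.
      by rewrite vpick0 -dimv_eq0 dl.
    have /(nonvanishing_at hp dl vl v0)/eqP pv := pl; split=> //.
    have [_ [d [a [b [ha hb bl ab]]]]] := sW _ Wl.
    have [c c0 vE] := line_mem_neq0 dl ul u0 vl v0.
    have c0' e : c ^+ e != 0 by rewrite expf_neq0.
    rewrite /h !(ab l) //; try exact/eqP.
    rewrite vE (peval_scale _ _ ha) (peval_scale _ _ hb) (peval_scale _ _ hp).
    have pu : peval p (vpick l) != 0.
      by apply/eqP/(nonvanishing_at hp dl ul u0).
    have bu : peval b (vpick l) != 0.
      by apply/eqP/(nonvanishing_at hb dl ul u0).
    rewrite exprD; move: (c0' d) (c0' k); move: (c ^+ d) (c ^+ k) => x y x0 y0.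
    by field; rewrite pu bu x0 y0.
  exists h.
    move=> l Wl; have [dl pl] := WU _ Wl.
    have [_ [d [a [b [ha hb bl ab]]]]] := sW _ Wl.
    exists (d + k)%N, a, (b * p); split=> //; first exact: hpolyM.
      exact/(nonvanishingM hb hp dl).
    move=> l' v Wl' bpl' vl' /eqP v0; have [dl' _] := WU _ Wl'.
    have [_ ->] := key l' v Wl' vl' v0.
    have [bl' _] := (nonvanishingM hb hp dl').1 bpl'.
    by rewrite (ab l') ?pevalM ?invfM ?mulrA //; apply/eqP.
  move=> l Wl; apply: funext => v; change (s l v = h l * psec p l v).
  rewrite /psec.
  case: ifP => [/andP[vl v0]|/negbT vn]; last first.
    have [s0 _] := sW _ Wl.
    rewrite mulr0 s0 //.
    by move=> [vl /eqP v0]; rewrite vl v0 in vn.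
  have [pv ->] := key l v Wl vl v0.
  by rewrite divfK.
have {}hs y v : W y -> s y v = h y * psec p y v by move=> /hs ->.
split.
  move=> v nv; rewrite hs //= /psec; case: ifP; last by rewrite mulr0.
  by move=> /andP[vl /eqP v0]; case: nv.
have [d [a [b [ha hb bl ab]]]] := rh _ Wl.
exists d, (a * p), b; split=> //; first exact: hpolyM.
move=> l' v Wl' bl' vl' v0; rewrite hs //= /psec vl' /=.
have -> : v != 0 by apply/eqP.
by rewrite (ab l' v) // pevalM mulrAC.
Qed.

Lemma O_on_frame (Z : set {vspace 'cV[F]_n}) k p : hpoly k p ->
  frame (L := O_on Z k) ((proj_space F n).(dom) `&` Z `&` pdomain p) (psec p).
Proof.
move=> hp; have rP := proj_space_ringed F n.
have rm : regular_map (subspace (proj_space F n) Z) (proj_space F n)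
    (fun l => l).
  split=> [l []//|W oW|W h oW rh x [[dx Zx] Wx]].
    exists W => //; apply/seteqP; split=> l /=; first by case=> [[]].
    by move=> [Wl Zl]; split=> //; split=> //; apply: (open_dom rP oW).
  by exists W, h; split.
have rZ : ringed (subspace (proj_space F n) Z) by apply: subspace_ringed.
exact: (frame_pullback rZ rP (@O_res k) rm (O_frame hp)).
Qed.

End TwistedBundles.

(** * Polynomial functions of one variable *)

Section PolynomialFunctions.
Variable F : fieldType.
Implicit Types (g h : F -> F).

Definition polyfun g : Prop := exists P : {poly F}, forall z, g z = P.[z].

Lemma polyfun_const c : polyfun (fun=> c).
Proof. by exists c%:P => z; rewrite hornerC. Qed.

Lemma polyfun_id : polyfun (fun z => z).
Proof. by exists 'X => z; rewrite hornerX. Qed.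

Lemma polyfunD g h : polyfun g -> polyfun h -> polyfun (fun z => g z + h z).
Proof. by move=> [P gP] [Q hQ]; exists (P + Q) => z; rewrite hornerD gP hQ. Qed.

Lemma polyfunM g h : polyfun g -> polyfun h -> polyfun (fun z => g z * h z).
Proof. by move=> [P gP] [Q hQ]; exists (P * Q) => z; rewrite hornerM gP hQ. Qed.

Lemma polyfun_sum (I : Type) (r : seq I) (g : I -> F -> F) :
  (forall i, polyfun (g i)) -> polyfun (fun z => \sum_(i <- r) g i z).
Proof.
move=> pg; elim: r => [|i r IH].
  by exists 0 => z; rewrite big_nil horner0.
have [P hP] := polyfunD (pg i) IH.
by exists P => z; rewrite big_cons hP.
Qed.

Lemma polyfun_prod (I : Type) (r : seq I) (g : I -> F -> F) :
  (forall i, polyfun (g i)) -> polyfun (fun z => \prod_(i <- r) g i z).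
Proof.
move=> pg; elim: r => [|i r IH].
  by exists 1 => z; rewrite big_nil hornerC.
have [P hP] := polyfunM (pg i) IH.
by exists P => z; rewrite big_cons hP.
Qed.

Lemma polyfunX g k : polyfun g -> polyfun (fun z => g z ^+ k).
Proof. by move=> [P gP]; exists (P ^+ k) => z; rewrite horner_exp gP. Qed.

Lemma polyfun_peval n (p : {mpoly F[n]}) (v : F -> 'cV[F]_n) :
  (forall i, polyfun (fun z => v z i 0)) -> polyfun (fun z => peval p (v z)).
Proof.
move=> pv.
have [P hP] : polyfun (fun z => \sum_(m <- msupp p)
    p@_m * \prod_(i <- index_enum 'I_n) v z i 0 ^+ m i).
  apply: polyfun_sum => m; apply: polyfunM; first exact: polyfun_const.
  by apply: polyfun_prod => i; apply: polyfunX.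
by exists P => z; rewrite -hP /peval mevalE.
Qed.

Lemma polyfun_det n (A : F -> 'M[F]_n) :
  (forall i j, polyfun (fun z => A z i j)) -> polyfun (fun z => \det (A z)).
Proof.
move=> pA; apply: polyfun_sum => s; apply: polyfunM; first exact: polyfun_const.
exact: polyfun_prod.
Qed.

End PolynomialFunctions.

Section ClosedField.
Variable F : closedFieldType.
Implicit Types (P Q : {poly F}) (g h : F -> F).

(** An algebraically closed field is infinite, so that two open conditions on a
    parameter that can be met separately can be met at once. *)
Lemma polyfun_avoid g h x y : polyfun g -> polyfun h ->
  g x != 0 -> h y != 0 -> exists z, g z != 0 /\ h z != 0.
Proof.
move=> [P gP] [Q hQ] gx hy.
have : P * Q != 0.
  rewrite mulf_neq0 //.
    by apply: contraNneq gx => P0; rewrite gP P0 horner0.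
  by apply: contraNneq hy => Q0; rewrite hQ Q0 horner0.
move=> /closed_nonrootP[z].
rewrite /root hornerM mulf_eq0 negb_or => /andP[? ?].
by exists z; rewrite gP hQ.
Qed.

Lemma poly_ext_neq0 P Q : (forall x, x != 0 -> P.[x] = Q.[x]) -> P = Q.
Proof.
move=> PQ; apply/eqP; rewrite -subr_eq0; apply/negP => /negP PQ0.
have : (P - Q) * 'X != 0 by rewrite mulf_neq0 ?polyX_eq0.
move=> /closed_nonrootP[z].
rewrite /root hornerM hornerX mulf_eq0 negb_or => /andP[+ z0].
by rewrite hornerD hornerN PQ // subrr eqxx.
Qed.

Lemma exists_root (c : F) n : (0 < n)%N -> exists x, x ^+ n = c.
Proof.
move=> n0; have /closed_rootP[x] : size ('X^n - c%:P) != 1%N.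
  by rewrite size_XnsubC // eqSS -lt0n.
by rewrite rootE !hornerE subr_eq0 => /eqP; exists x.
Qed.

End ClosedField.

(** * Binary forms *)

Section BinaryForms.
Variable F : closedFieldType.
Implicit Types (v w : 'cV[F]_2).

Definition vec2 (x y : F) : 'cV[F]_2 := \col_i (if i == 0 then x else y).

Lemma vec2K v : vec2 (v 0 0) (v 1 0) = v.
Proof.
apply/matrixP => i j; rewrite ord1 mxE.
by case: i => [[|[|//]]] hi; congr (v _ _); apply: val_inj.
Qed.

Lemma vec2_0 x y : vec2 x y 0 0 = x. Proof. by rewrite mxE. Qed.
Lemma vec2_1 x y : vec2 x y 1 0 = y. Proof. by rewrite mxE. Qed.

Lemma vec2_eq0 v : (v == 0) = (v 0 0 == 0) && (v 1 0 == 0).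
Proof.
apply/eqP/andP => [->|[/eqP v0 /eqP v1]]; first by rewrite !mxE eqxx.
apply/matrixP => i j; rewrite -(vec2K v) v0 v1 !mxE.
by case: ifP.
Qed.

Lemma vec2Z c x y : c *: vec2 x y = vec2 (c * x) (c * y).
Proof. by apply/matrixP => i j; rewrite !mxE; case: ifP. Qed.

(** The linear form vanishing on the line of w. *)
Definition lpoly w : {mpoly F[2]} := w 1 0 *: 'X_0 - w 0 0 *: 'X_1.

Lemma lpoly_hpoly w : hpoly 1 (lpoly w).
Proof.
apply: hpolyD; first by apply: hpolyZ; apply: hpolyXU.
by rewrite -scaleNr; apply: hpolyZ; apply: hpolyXU.
Qed.

Lemma lpolyE w v : peval (lpoly w) v = w 1 0 * v 0 0 - w 0 0 * v 1 0.
Proof. by rewrite /lpoly -scaleNr pevalD !pevalZ !pevalXU mulNr. Qed.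

Lemma lpoly_eq0 w v : w != 0 -> v != 0 -> peval (lpoly w) v = 0 ->
  exists2 c, c != 0 & v = c *: w.
Proof.
rewrite lpolyE => w0 v0 /eqP; rewrite subr_eq0 => /eqP wv.
suff [c vE] : exists c, v = c *: w.
  exists c => //; apply: contraNneq v0 => c0; by rewrite vE c0 scale0r.
have [w00|w00] := eqVneq (w 0 0) 0.
  have w10 : w 1 0 != 0 by move: w0; rewrite vec2_eq0 w00 eqxx.
  exists (v 1 0 / w 1 0).
  transitivity ((v 1 0 / w 1 0) *: vec2 (w 0 0) (w 1 0)); last by rewrite vec2K.
  rewrite -[LHS]vec2K vec2Z w00 divfK // mulr0.
  congr vec2; apply: (mulfI w10); rewrite wv w00.
  by rewrite mulr0 mul0r.
exists (v 0 0 / w 0 0).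
transitivity ((v 0 0 / w 0 0) *: vec2 (w 0 0) (w 1 0)); last by rewrite vec2K.
rewrite -[LHS]vec2K vec2Z divfK //.
by congr vec2; rewrite mulrAC -[v 0 0 * _]mulrC wv mulrC mulKf.
Qed.

(** Factor the polynomial on one standard chart. The polynomial on the other
    chart bounds the number of roots by the degree, and each missing root is a
    root at infinity, the line of (-1, 0). *)
Lemma binary_factor (g : 'cV[F]_2 -> F) d :
  (forall c v, c != 0 -> v != 0 -> g (c *: v) = c ^+ d * g v) ->
  polyfun (fun x => g (vec2 x 1)) -> polyfun (fun y => g (vec2 1 y)) ->
  (exists2 v, v != 0 & g v != 0) ->
  exists c L, [/\ c != 0, size L = d, {in L, forall w, w != 0} &
    forall v, v != 0 -> g v = c * \prod_(w <- L) peval (lpoly w) v].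
Proof.
move=> gh [G1 g1] [G2 g2] [v0 v00 gv0].
have gE1 v : v 1 0 != 0 -> g v = v 1 0 ^+ d * G1.[v 0 0 / v 1 0].
  move=> v1; rewrite -g1 -gh //; last by rewrite vec2_eq0 vec2_1 oner_eq0 andbF.
  by rewrite vec2Z mulr1 mulrCA divff // mulr1 vec2K.
have gE2 v : v 0 0 != 0 -> g v = v 0 0 ^+ d * G2.[v 1 0 / v 0 0].
  move=> v1; rewrite -g2 -gh //; last by rewrite vec2_eq0 vec2_0 oner_eq0.
  by rewrite vec2Z mulr1 mulrCA divff // mulr1 vec2K.
have G21 y : y != 0 -> G2.[y] = y ^+ d * G1.[y^-1].
  by move=> y0; rewrite -g2 gE1 vec2_1 // vec2_0 div1r.
have G10 : G1 != 0.
  apply/eqP => G10; have G20 : G2 = 0.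
    by apply: poly_ext_neq0 => x x0; rewrite G21 // G10 !horner0 mulr0.
  move: v00; rewrite vec2_eq0 negb_and => /orP[] vi; move: gv0.
    by rewrite gE2 // G20 horner0 mulr0 eqxx.
  by rewrite gE1 // G10 horner0 mulr0 eqxx.
have [rs G1E] := closed_field_poly_normal G1.
set c := lead_coef G1 in G1E.
have c0 : c != 0 by rewrite lead_coef_eq0.
have G1x x : G1.[x] = c * \prod_(r <- rs) (x - r).
  rewrite G1E hornerZ horner_prod; congr (_ * _); apply: eq_bigr => r _.
  by rewrite hornerXsubC.
pose Q := c *: \prod_(r <- rs) (1 - r *: 'X).
have Qx y : Q.[y] = c * \prod_(r <- rs) (1 - r * y).
  rewrite hornerZ horner_prod; congr (_ * _); apply: eq_bigr => r _.
  by rewrite hornerD hornerN hornerZ hornerX hornerC.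
have QG y : y != 0 -> y ^+ size rs * G1.[y^-1] = Q.[y].
  move=> y0; rewrite G1x Qx mulrCA; congr (_ * _).
  rewrite -[_ ^+ _](_ : \prod_(r <- rs) y = _); last first.
    by rewrite big_const_seq count_predT iter_mulr_1.
  rewrite -big_split /=; apply: eq_bigr => r _.
  by rewrite mulrBr divff // mulrC.
have Q0 : Q.[0] = c.
  by rewrite Qx big1 ?mulr1 // => r _; rewrite mulr0 subr0.
have sz : (size rs <= d)%N.
  rewrite leqNgt; apply/negP => lt.
  have : 'X^(size rs - d) * G2 = Q.
    apply: poly_ext_neq0 => x x0.
    by rewrite hornerM hornerXn G21 // mulrA -exprD subnK ?QG // ltnW.
  move=> /(congr1 (horner^~ 0)); rewrite hornerM hornerXn expr0n.
  rewrite subn_eq0 leqNgt lt mul0r Q0 => /esym/eqP.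
  by rewrite (negbTE c0).
have G2E : G2 = 'X^(d - size rs) * Q.
  apply: poly_ext_neq0 => x x0.
  by rewrite hornerM hornerXn G21 // -QG // mulrA -exprD subnK.
exists c, (nseq (d - size rs) (vec2 (-1) 0) ++ [seq vec2 r 1 | r <- rs]); split.
- by [].
- by rewrite size_cat size_nseq size_map subnK.
- move=> w; rewrite mem_cat => /orP[/nseqP[-> _]|/mapP[r _ ->]];
    rewrite vec2_eq0 vec2_0 vec2_1 ?oppr_eq0 oner_eq0 ?andbF //.
move=> v v0'; rewrite big_cat /= big_map big_nseq.
rewrite iter_mulr_1 lpolyE vec2_0 vec2_1.
rewrite mul0r mulN1r sub0r opprK.
under eq_bigr do rewrite lpolyE vec2_0 vec2_1 mul1r.
have [v1|v1] := eqVneq (v 1 0) 0.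
  have w0 : v 0 0 != 0 by move: v0'; rewrite vec2_eq0 v1 eqxx andbT.
  rewrite gE2 // v1 mul0r G2E hornerM hornerXn Q0.
  under eq_bigr do rewrite mulr0 subr0.
  rewrite big_const_seq count_predT iter_mulr_1.
  rewrite expr0n subn_eq0; case le: (d <= size rs)%N;
    last by rewrite !(mul0r, mulr0).
  by rewrite (_ : size rs = d) ?mul1r 1?mulrC //; apply/eqP; rewrite eqn_leq sz.
have key : \prod_(r <- rs) (v 0 0 - r * v 1 0) =
    v 1 0 ^+ size rs * \prod_(r <- rs) (v 0 0 / v 1 0 - r).
  rewrite -[_ ^+ _](_ : \prod_(r <- rs) v 1 0 = _); last first.
    by rewrite big_const_seq count_predT iter_mulr_1.
  rewrite -big_split /=; apply: eq_bigr => r _.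
  by rewrite mulrBr mulrCA divff // mulr1 [v 1 0 * r]mulrC.
rewrite gE1 // G1x key -[d in v 1 0 ^+ d](subnK sz) exprD.
move: (v 1 0 ^+ _) (v 1 0 ^+ _) (\prod_(r <- rs) _) => a b e.
by ring.
Qed.

Lemma lprod_hpoly (L : seq 'cV[F]_2) : hpoly (size L) (\prod_(w <- L) lpoly w).
Proof.
elim: L => [|w L IH]; first by rewrite big_nil; apply: dhomog1.
by rewrite big_cons; apply: (hpolyM (lpoly_hpoly w) IH).
Qed.

Lemma lprodE (L : seq 'cV[F]_2) v :
  peval (\prod_(w <- L) lpoly w) v = \prod_(w <- L) peval (lpoly w) v.
Proof. by rewrite /peval rmorph_prod. Qed.

Lemma binary_form (g : 'cV[F]_2 -> F) d :
  (forall c v, c != 0 -> v != 0 -> g (c *: v) = c ^+ d * g v) ->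
  polyfun (fun x => g (vec2 x 1)) -> polyfun (fun y => g (vec2 1 y)) ->
  exists2 p, hpoly d p & forall v, v != 0 -> g v = peval p v.
Proof.
move=> gh g1 g2.
have [g0|g0] := pselect (exists2 v, v != 0 & g v != 0); last first.
  exists 0; first exact: hpoly0.
  move=> v v0; rewrite /peval meval0; apply/eqP/negP => /negP gv.
  by apply: g0; exists v.
have [c [L [c0 szL L0 gE]]] := binary_factor gh g1 g2 g0.
exists (c *: \prod_(w <- L) lpoly w).
  by rewrite -szL; apply/hpolyZ/lprod_hpoly.
by move=> v v0; rewrite pevalZ lprodE gE.
Qed.

Lemma hpoly_factor d (p : {mpoly F[2]}) : hpoly d p ->
  (exists2 v, v != 0 & peval p v != 0) ->
  exists c L, [/\ c != 0, size L = d, {in L, forall w, w != 0} &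
    forall v, v != 0 -> peval p v = c * \prod_(w <- L) peval (lpoly w) v].
Proof.
move=> hp; apply: binary_factor => [c v _ _||]; first exact: peval_scale.
  apply: polyfun_peval => i; have [->|i0] := eqVneq i 0.
    by exists 'X => z; rewrite vec2_0 hornerX.
  by exists 1 => z; rewrite mxE (negbTE i0) hornerC.
apply: polyfun_peval => i; have [->|i0] := eqVneq i 0.
  by exists 1 => z; rewrite vec2_0 hornerC.
by exists 'X => z; rewrite mxE (negbTE i0) hornerX.
Qed.

End BinaryForms.

(** * Proj of the second Veronese ring of the projective line *)

(** Restriction along sg identifies the elements of degree m of S with the
    binary forms of degree 2m. The vector 0, which spans no point of the
    projective line, is left out. *)
Record veronese (F : fieldType) (I : Type) (S : nat -> set (I -> F^o))
    (sg : 'cV[F]_2 -> I) : Prop := Veronese {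
  ver_form : forall m f, S m f ->
    exists2 p, hpoly m.*2 p &
      forall v : 'cV[F]_2, v != 0 -> f (sg v) = peval p v;
  ver_surj : forall m p, hpoly m.*2 p ->
    exists2 f, S m f & forall v : 'cV[F]_2, v != 0 -> f (sg v) = peval p v;
  ver_inj : forall m f g, S m f -> S m g ->
    (forall v : 'cV[F]_2, v != 0 -> f (sg v) = g (sg v)) -> f = g;
  ver_lin : forall m (c : F) (f g : I -> F^o),
    S m f -> S m g -> S m (c *: f + g);
  ver_mul : forall k m (f g : I -> F^o), S k f -> S m g -> S (k + m)%N (f * g)
}.

Section VeroneseProj.
Variables (F : closedFieldType) (I : Type).
Variables (S : nat -> set (I -> F^o)) (sg : 'cV[F]_2 -> I).
Hypothesis hv : veronese S sg.
Local Notation A := (I -> F^o).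
Implicit Types (v w : 'cV[F]_2) (P Q : nat -> set A) (f g : A).

Lemma ver_scale m f c v : S m f -> v != 0 -> c != 0 ->
  f (sg (c *: v)) = c ^+ m.*2 * f (sg v).
Proof.
move=> /(ver_form hv)[p hp fp] v0 c0.
by rewrite !fp ?scaler_eq0 ?negb_or ?c0 // (peval_scale _ _ hp).
Qed.

Lemma ver0 m : S m 0.
Proof.
have [f Sf _] := ver_surj hv (hpoly0 F 2 m.*2).
by have := ver_lin hv (-1) Sf Sf; rewrite scaleN1r addNr.
Qed.

Lemma verZ m c f : S m f -> S m (c *: f).
Proof. by move=> Sf; have := ver_lin hv c Sf (ver0 m); rewrite addr0. Qed.

Lemma verD m f g : S m f -> S m g -> S m (f + g).
Proof. by move=> Sf Sg; have := ver_lin hv 1 Sf Sg; rewrite scale1r. Qed.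

Lemma verB m f g : S m f -> S m g -> S m (f - g).
Proof. by move=> Sf /(verZ (-1)); rewrite scaleN1r; apply: verD. Qed.

Lemma prime_sub P m f : relevant_prime S P -> P m f -> S m f.
Proof. by case=> PS _ _ _ _ /PS. Qed.

Lemma prime0 P m : relevant_prime S P -> P m 0.
Proof. by case=> _ /(_ m)[]. Qed.

Lemma primeD P m f g : relevant_prime S P -> P m f -> P m g -> P m (f + g).
Proof. by case=> _ /(_ m)[_ +] _ _ _; apply. Qed.

Lemma primeMl P k m f g : relevant_prime S P -> S k f -> P m g ->
  P (k + m)%N (f * g).
Proof. by case=> _ _ + _ _; apply. Qed.

Lemma primeMr P k m f g : relevant_prime S P -> P k f -> S m g ->
  P (k + m)%N (f * g).
Proof. by move=> rP Pf Sg; rewrite addnC mulrC; apply: primeMl. Qed.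

Lemma primeM P k m f g : relevant_prime S P -> S k f -> S m g ->
  ~ P k f -> ~ P m g -> ~ P (k + m)%N (f * g).
Proof. by move=> [_ _ _ pP _] Sf Sg nf ng /pP[]. Qed.

(** The homogeneous ideal of the point of the projective line spanned by w. *)
Definition pid w : nat -> set A := fun m => [set f | S m f /\ f (sg w) = 0].

Lemma pid_scale c w : c != 0 -> w != 0 -> pid (c *: w) = pid w.
Proof.
move=> c0 w0; apply: funext => m; apply/seteqP.
split=> f [Sf fw]; split=> //; move: fw; rewrite (ver_scale Sf) //.
  by move=> /eqP; rewrite mulf_eq0 expf_eq0 (negbTE c0) andbF => /eqP.
by move=> ->; rewrite mulr0.
Qed.

Lemma ver_sqr w : exists2 f, S 1 f &
  forall v, v != 0 -> f (sg v) = peval (lpoly w) v ^+ 2.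
Proof.
have [f Sf fE] := ver_surj hv (hpolyXn 2 (lpoly_hpoly w) : hpoly 1.*2 _).
by exists f => // v /fE ->; rewrite pevalXn.
Qed.

Lemma lpoly_self w : peval (lpoly w) w = 0.
Proof. by rewrite lpolyE mulrC subrr. Qed.

Lemma lpoly_other w : w != 0 -> exists u, peval (lpoly u) w != 0.
Proof.
rewrite vec2_eq0 negb_and => /orP[w0|w1].
  by exists (vec2 0 1); rewrite lpolyE vec2_0 vec2_1 mul0r subr0 mul1r.
by exists (vec2 (-1) 0); rewrite lpolyE vec2_0 vec2_1 mul0r mulN1r sub0r opprK.
Qed.

Lemma pid_prime w : w != 0 -> relevant_prime S (pid w).
Proof.
move=> w0; split=> [m f []//|m|k m f g Sf [Sg gw]|k m f g Sf Sg [_ /= fg]|].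
- split=> [|f g [Sf fw] [Sg gw]]; first by split; [apply: ver0|].
  by split; [apply: verD|change (f (sg w) + g (sg w) = 0); rewrite fw gw addr0].
- split; first exact: (ver_mul hv).
  by change (f (sg w) * g (sg w) = 0); rewrite gw mulr0.
- have /eqP : f (sg w) * g (sg w) = 0 by [].
  by rewrite mulf_eq0 => /orP[]/eqP; [left|right].
have [u uw] := lpoly_other w0; have [f Sf fE] := ver_sqr u.
exists 1%N, f; split=> // -[_]; rewrite fE // => /eqP.
by rewrite sqrf_eq0 (negbTE uw).
Qed.

Definition has_sqr P w : Prop := exists2 f, P 1%N f &
  forall v, v != 0 -> f (sg v) = peval (lpoly w) v ^+ 2.

Lemma prime_has_sqr P (L : seq 'cV[F]_2) c f : relevant_prime S P ->
  c != 0 -> P (size L) f ->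
  (forall v, v != 0 ->
     f (sg v) = c * \prod_(w <- L) peval (lpoly w) v ^+ 2) ->
  exists2 w, w \in L & has_sqr P w.
Proof.
move=> rP c0; elim: L f => [|w L IH] f Pf fE.
  case: (rP) => _ _ _ _ [m [g [m0 Sg nPg]]]; case: nPg.
  rewrite -[m]addn0 (_ : g = (c^-1 *: g) * f).
    by apply: primeMl => //; apply: verZ.
  have Sf := prime_sub rP Pf.
  apply: (ver_inj hv Sg).
    by have := ver_mul hv (verZ c^-1 Sg) Sf; rewrite addn0.
  move=> v v0; change (g (sg v) = c^-1 * g (sg v) * f (sg v)).
  by rewrite fE // big_nil mulr1 mulrAC mulVf // mul1r.
have [h Sh hE] := ver_sqr w.
have hp : hpoly (size L).*2 (c *: (\prod_(u <- L) lpoly u) ^+ 2).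
  by rewrite -muln2; apply/hpolyZ/hpolyXn/lprod_hpoly.
have [g Sg gE'] := ver_surj hv hp.
have gE v : v != 0 -> g (sg v) = c * \prod_(u <- L) peval (lpoly u) v ^+ 2.
  by move=> /gE' ->; rewrite pevalZ pevalXn lprodE prodrXl.
have fhg : f = h * g.
  apply: (ver_inj hv (prime_sub rP Pf) (ver_mul hv Sh Sg)) => v v0.
  change (f (sg v) = h (sg v) * g (sg v)).
  by rewrite fE // hE // gE // big_cons mulrCA.
move: Pf; rewrite fhg /= -add1n => Pf.
case: (rP) => _ _ _ pP _; have [Ph|Pg] := pP _ _ _ _ Sh Sg Pf.
  by exists w; rewrite ?mem_head //; exists h.
by have [u uL Pu] := IH g Pg gE; exists u => //; rewrite in_cons uL orbT.
Qed.

(** As an element of degree m is a form of degree 2m, its square is a product of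
    squares of linear forms, which are elements of degree 1; a prime ideal
    contains one of them. *)
Lemma prime_neq0 P m f v : relevant_prime S P -> P m f -> v != 0 ->
  f (sg v) != 0 -> exists w, [/\ w != 0, has_sqr P w & f (sg w) = 0].
Proof.
move=> rP Pf v0 fv; have Sf := prime_sub rP Pf.
have [p hp fp] := ver_form hv Sf.
have [|c [L [c0 szL L0 pE]]] := hpoly_factor hp.
  by exists v; rewrite -?fp.
have Pff : P (size L) (f * f) by rewrite szL -addnn; apply: primeMl.
have [||w wL Pw] := prime_has_sqr rP (_ : c ^+ 2 != 0) Pff.
- by rewrite expf_neq0.
- move=> u u0.
  change (f (sg u) * f (sg u) =
    c ^+ 2 * \prod_(w <- L) peval (lpoly w) u ^+ 2).
  by rewrite fp // pE // prodrXl -exprMn expr2.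
exists w; split=> //; first exact: L0.
rewrite fp ?L0 // pE ?L0 //.
by rewrite (big_rem w wL) /= lpoly_self mul0r mulr0.
Qed.

(** If f vanishes at w, its square is divisible by the square of the linear form
    of w, with a quotient of even degree. *)
Lemma has_sqr_sub P w m f : relevant_prime S P -> w != 0 -> has_sqr P w ->
  pid w m f -> P m f.
Proof.
move=> rP w0 [g Pg gE] [Sf fw].
have [p hp fp] := ver_form hv Sf.
have [[v v0 pv]|nz] := pselect (exists2 v, v != 0 & peval p v != 0); last first.
  rewrite (_ : f = 0); first exact: prime0.
  apply: (ver_inj hv Sf (ver0 m)) => v v0; rewrite fp //.
  by apply/eqP/negP => /negP pv; apply: nz; exists v.
have [|c [L [c0 szL L0 pE]]] := hpoly_factor hp; first by exists v.
have [w' w'L w'w] : exists2 w', w' \in L & peval (lpoly w') w = 0.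
  move: fw; rewrite fp // pE // => /eqP; rewrite mulf_eq0 (negbTE c0) /=.
  rewrite prodf_seq_eq0 => /hasP[w' w'L /= /eqP]; by exists w'.
have w'0 := L0 _ w'L.
have [a a0 wE] := lpoly_eq0 w'0 w0 w'w.
have hq : hpoly (m.*2.-1).*2
    ((c / a) ^+ 2 *: (\prod_(u <- rem w' L) lpoly u) ^+ 2).
  rewrite -[in m.*2.-1]szL -(size_rem w'L) -muln2.
  exact/hpolyZ/hpolyXn/lprod_hpoly.
have [h Sh hE] := ver_surj hv hq.
have mm : (m.*2.-1 + 1)%N = (m + m)%N.
  rewrite addnn addn1 prednK // -szL.
  by case: (L) w'L.
have ff : f * f = h * g.
  have Shg := ver_mul hv Sh (prime_sub rP Pg); rewrite mm in Shg.
  apply: (ver_inj hv (ver_mul hv Sf Sf) Shg) => u u0.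
  change (f (sg u) * f (sg u) = h (sg u) * g (sg u)).
  rewrite fp // pE // hE // gE // pevalZ pevalXn lprodE (big_rem w' w'L) /=.
  rewrite wE !lpolyE !mxE; move: (\prod_(_ <- _) _) => e.
  by field.
have Pff : P (m + m)%N (f * f) by rewrite ff -mm; apply: primeMl.
by case: (rP) => _ _ _ pP _; case: (pP _ _ _ _ Sf Sf Pff).
Qed.

Lemma has_sqr_pid P w : relevant_prime S P -> w != 0 -> has_sqr P w ->
  P = pid w.
Proof.
move=> rP w0 Pw; apply: funext => m; apply/seteqP; split=> f; last first.
  exact: has_sqr_sub.
move=> Pf; have Sf := prime_sub rP Pf; split=> //.
apply/eqP/negP => /negP fw.
have [w' [w'0 Pw' fw']] := prime_neq0 rP Pf w0 fw.
have w'w : peval (lpoly w') w != 0.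
  apply/eqP => /(lpoly_eq0 w'0 w0)[a a0 wE]; move: fw.
  by rewrite wE (ver_scale Sf) // fw' mulr0 eqxx.
(* Two distinct points generate an irrelevant ideal. *)
case: (rP) => _ _ _ _ [k [g [k0 Sg]]]; apply.
have hw' := hpolyXn k.*2 (lpoly_hpoly w'); rewrite mul1n in hw'.
have [e Se eE] := ver_surj hv hw'.
have ew : e (sg w) != 0 by rewrite eE // pevalXn expf_neq0.
pose c := g (sg w) / e (sg w).
have Sce := verZ c Se.
rewrite -(subrK (c *: e) g); apply: primeD => //.
  apply: (has_sqr_sub rP w0 Pw); split; first exact: verB.
  by change (g (sg w) - c * e (sg w) = 0); rewrite divfK // subrr.
apply: (has_sqr_sub rP w'0 Pw'); split=> //.
change (c * e (sg w') = 0); rewrite eE // pevalXn lpoly_self expr0n.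
by rewrite double_eq0 eqn0Ngt k0 mulr0.
Qed.

Lemma pid_closed w : w != 0 -> closed_point S (pid w).
Proof.
move=> w0; split=> [|Q rQ wQ]; first exact: pid_prime.
apply: has_sqr_pid => //; have [f Sf fE] := ver_sqr w.
exists f => //; apply: wQ; split=> //.
by rewrite fE // lpoly_self expr0n.
Qed.

(** A closed point other than the zero ideal contains a square of a linear form;
    the zero ideal is smaller than the ideal of any point. *)
Lemma closed_pointE P : closed_point S P -> exists2 w, w != 0 & pid w = P.
Proof.
move=> [rP mP].
have [[m [f [v [Pf v0 fv]]]]|Pz] := pselect
    (exists m f v, [/\ P m f, v != 0 & f (sg v) != 0]).
  have [w [w0 Pw _]] := prime_neq0 rP Pf v0 fv.
  by exists w => //; rewrite (has_sqr_pid rP w0 Pw).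
have w0 : vec2 (1 : F) 0 != 0 by rewrite vec2_eq0 vec2_0 oner_eq0.
exists (vec2 1 0) => //; apply: mP => [|m f Pf]; first exact: pid_prime.
split; first exact: prime_sub Pf.
by apply/eqP/negP => /negP fv; apply: Pz; exists m, f, (vec2 1 0).
Qed.

Lemma pid_inj w w' : w != 0 -> w' != 0 -> pid w = pid w' ->
  exists2 c, c != 0 & w' = c *: w.
Proof.
move=> w0 w'0 ww'; apply: lpoly_eq0 => //.
have [f Sf fE] := ver_sqr w.
have : pid w 1%N f by split=> //; rewrite fE // lpoly_self expr0n.
by rewrite ww' => -[_]; rewrite fE // => /eqP; rewrite sqrf_eq0 => /eqP.
Qed.

Lemma fun_scaleAl (c : F) f g : c *: (f * g) = (c *: f) * g.
Proof. by apply: funext => i; exact: mulrA. Qed.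

Lemma Proj_ringed : ringed (Proj S).
Proof.
split=> /=.
- by move=> U P hU /hU[].
- move=> U W hU hW P [UP WP]; have [cP [m [f [m0 Sf nf fU]]]] := hU _ UP.
  have [_ [k [g [k0 Sg ng gW]]]] := hW _ WP.
  split=> //; exists (m + k)%N, (f * g); split.
  + by rewrite addn_gt0 m0.
  + exact: (ver_mul hv).
  + by apply: primeM => //; case: cP.
  + move=> Q cQ; have [rQ _] := cQ => nfg; split.
      by apply: fU => // Qf; apply: nfg; apply: primeMr.
    by apply: gW => // Qg; apply: nfg; apply: primeMl.
- move=> U W h WU hU P /WU /hU[m [a [b [Sa Sb nb ab]]]].
  by exists m, a, b; split=> // Q /WU; apply: ab.
- move=> U h oU hU P UP; have [W [k [oW WP rk hk]]] := hU _ UP.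
  have [m [a [b [Sa Sb nb ab]]]] := rk _ WP.
  have [cP [j [f [j0 Sf nf fW]]]] := oW _ WP.
  exists (m + j)%N, (a * f), (b * f); split; try exact: (ver_mul hv).
    by apply: primeM => //; case: cP.
  move=> Q UQ nbf; have [cQ _] := oU _ UQ; have [rQ _] := cQ.
  have WQ : W Q by apply: fW => // Qf; apply: nbf; apply: primeMl.
  rewrite hk // fun_scaleAl -mulrBl; apply: primeMr => //; apply: ab => // Qb.
  by apply: nbf; apply: primeMr.
- move=> U oU P UP; have [[rP _] [m [f [m0 Sf nf fU]]]] := oU _ UP.
  exists m, f, f; split=> // Q UQ _; have [[rQ _] _] := oU _ UQ.
  by rewrite scale1r subrr; apply: prime0.
- move=> U h k oU hU kU P UP.
  have [m [a [b [Sa Sb nb ab]]]] := hU _ UP.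
  have [m' [a' [b' [Sa' Sb' nb' ab']]]] := kU _ UP.
  exists (m + m')%N, (a * a'), (b * b'); split; try exact: (ver_mul hv).
    by have [[rP _] _] := oU _ UP; apply: primeM.
  move=> Q UQ nbb; have [[rQ _] _] := oU _ UQ.
  have -> : a * a' - (h Q * k Q) *: (b * b') =
      (a - h Q *: b) * a' + (h Q *: b) * (a' - k Q *: b').
    apply: funext => i.
    change (a i * a' i - (h Q * k Q) * (b i * b' i) =
      (a i - h Q * b i) * a' i + (h Q * b i) * (a' i - k Q * b' i)).
    by ring.
  apply: primeD => //.
    apply: primeMr => //; apply: ab => // Qb; apply: nbb; exact: primeMr.
  apply: primeMl => //; first exact: verZ.
  by apply: ab' => // Qb; apply: nbb; exact: primeMl.
Qed.

Definition pointP : pt (Proj S) -> pt (proj_space F 2) :=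
  fun P => <[xget 0%R [set w : 'cV[F]_2 | w != 0%R /\ pid w = P]]>%VS.

Definition pidl : pt (proj_space F 2) -> pt (Proj S) :=
  fun l : {vspace 'cV[F]_2} => pid (vpick l).

Lemma pointP_pid w : w != 0 -> pointP (pid w) = <[w]>%VS.
Proof.
move=> w0; rewrite /pointP.
have := @xgetPex _ 0 [set u : 'cV[F]_2 | u != 0 /\ pid u = pid w]
  (ex_intro _ w (conj w0 erefl)).
set u := xget _ _ => -[u0 uw].
have [c c0 ->] := pid_inj u0 w0 uw.
apply/esym/line_ext; rewrite ?dim_line ?scaler_eq0 ?negb_or ?c0 //.
by apply/vlineP; exists c^-1; rewrite scalerA mulVf // scale1r.
Qed.

Lemma pidl_line l v : \dim l = 1%N -> v \in l -> v != 0 -> pidl l = pid v.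
Proof.
move=> dl vl v0; have u0 : vpick l != 0 by rewrite vpick0 -dimv_eq0 dl.
have [c c0 ->] := line_mem_neq0 dl (memv_pick l) u0 vl v0.
by rewrite pid_scale.
Qed.

Lemma pointP_pidl l : \dim l = 1%N -> pointP (pidl l) = l.
Proof.
move=> dl; have [v v0 lE] := dim1_line dl.
by rewrite (@pidl_line _ v) ?lE ?memv_line ?dim_line // pointP_pid.
Qed.

Lemma pidl_pointP P : closed_point S P -> pidl (pointP P) = P.
Proof.
move=> /closed_pointE[w w0 <-]; rewrite pointP_pid //.
by rewrite (@pidl_line _ w) ?memv_line ?dim_line.
Qed.

Lemma pointP_dim P : closed_point S P -> \dim (pointP P) = 1%N.
Proof. by move=> /closed_pointE[w w0 <-]; rewrite pointP_pid ?dim_line. Qed.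

Lemma pidl_closed l : \dim l = 1%N -> closed_point S (pidl l).
Proof. by move=> dl; apply: pid_closed; rewrite vpick0 -dimv_eq0 dl. Qed.

(** Squaring a form makes its degree even, hence turns it into an element of the
    Veronese ring without changing where it vanishes. *)
Lemma pointP_regular : regular_map (Proj S) (proj_space F 2) pointP.
Proof.
split=> /= [P cP|W oW P [cP WP]|W h oW rh P [cP WP]].
- exact: pointP_dim.
- have [w w0 wP] := closed_pointE cP; rewrite -wP in cP WP *.
  move: WP; rewrite /preimage /= pointP_pid // => /oW[_ [d [p [hp pw pW]]]].
  have [u uw] := lpoly_other w0.
  split=> //; have hq := hpolyXn 2 (hpolyM hp (lpoly_hpoly u)).
  rewrite muln2 in hq; have [f Sf fE] := ver_surj hv hq.
  exists (d + 1)%N, f; split=> //; first by rewrite addn1.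
    move=> [_]; rewrite fE // pevalXn => /eqP.
    rewrite sqrf_eq0 pevalM mulf_eq0 (negbTE uw) orbF => /eqP.
    by have [+ _] := nonvanishing_line hp w0; apply.
  move=> Q cQ; have [v v0 vQ] := closed_pointE cQ; rewrite -vQ => nf.
  split; first by rewrite vQ.
  rewrite pointP_pid //; apply: pW; rewrite ?dim_line //.
  apply/(nonvanishing_line hp v0) => pv; apply: nf; split=> //.
  by rewrite fE // pevalXn pevalM pv mul0r expr0n.
have [w w0 wP] := closed_pointE cP; rewrite -wP in cP WP *.
move: WP; rewrite /= pointP_pid // => /rh[d [a [b [ha hb bw ab]]]].
have hab := hpolyM ha hb; rewrite addnn in hab.
have hbb := hpolyM hb hb; rewrite addnn in hbb.
have [f Sf fE] := ver_surj hv hab; have [g Sg gE] := ver_surj hv hbb.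
exists d, f, g; split=> //.
  move=> [_]; rewrite gE // pevalM => /eqP; rewrite mulf_eq0 orbb => /eqP.
  by have [+ _] := nonvanishing_line hb w0; apply.
move=> Q [cQ WQ]; have [v v0 vQ] := closed_pointE cQ; rewrite -vQ in WQ * => nf.
have bv : peval b v <> 0.
  by move=> bv; apply: nf; split=> //; rewrite gE // pevalM bv mul0r.
split; first by apply: verB => //; apply: verZ.
change (f (sg v) - h (pointP (pid v)) * g (sg v) = 0).
move: WQ; rewrite /= pointP_pid // => WQ.
rewrite (ab _ v WQ) ?memv_line //; try exact/eqP.
  rewrite fE // gE // !pevalM mulrA divfK ?subrr //; exact/eqP.
exact/(nonvanishing_line hb v0).
Qed.

Lemma pidl_regular : regular_map (proj_space F 2) (Proj S) pidl.
Proof.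
split=> /= [l dl|W oW l [dl Wl]|W h oW rh l [dl Wl]].
- exact: pidl_closed.
- have [v v0 lE] := dim1_line dl.
  have lv : pidl l = pid v by apply: pidl_line => //; rewrite lE memv_line.
  rewrite /= lv in Wl; have [_ [m [f [m0 Sf nf fW]]]] := oW _ Wl.
  have [p hp fp] := ver_form hv Sf; split=> //; exists m.*2, p; split=> //.
    rewrite lE; apply/(nonvanishing_line hp v0) => pv; apply: nf.
    by split; rewrite ?fp.
  move=> l' dl' pl'; split=> //=; have [u u0 l'E] := dim1_line dl'.
  rewrite (@pidl_line _ u) ?l'E ?memv_line ?dim_line //.
  apply: fW; first exact: pid_closed.
  move=> [_]; rewrite fp //; move: pl'; rewrite l'E.
  by move=> /(nonvanishing_line hp u0).
have [v v0 lE] := dim1_line dl.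
have lv : pidl l = pid v by apply: pidl_line => //; rewrite lE memv_line.
rewrite /= lv in Wl; have [m [a [b [Sa Sb nb ab]]]] := rh _ Wl.
have [p hp ap] := ver_form hv Sa; have [q hq bq] := ver_form hv Sb.
exists m.*2, p, q; split=> //.
  rewrite lE; apply/(nonvanishing_line hq v0) => qv; apply: nb.
  by split; rewrite ?bq.
move=> l' u [dl' Wl'] ql' ul' /eqP u0.
have /(nonvanishing_at hq dl' ul' u0) qu := ql'.
have l'u := pidl_line dl' ul' u0; rewrite /= l'u in Wl' *.
have [] := ab _ Wl'; first by move=> [_]; rewrite bq.
move=> _; change (a (sg u) - h (pid u) * b (sg u) = 0 ->
  h (pid u) = peval p u / peval q u).
rewrite ap // bq // => /eqP; rewrite subr_eq0 => /eqP ->.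
by rewrite mulfK //; apply/eqP.
Qed.

Lemma pointP_biregular : biregular (Proj S) (proj_space F 2) pointP.
Proof.
split; first exact: pointP_regular.
exists pidl; split; first exact: pidl_regular.
  by move=> P; apply: pidl_pointP.
by move=> l; apply: pointP_pidl.
Qed.

End VeroneseProj.

(** * Exterior powers in Plücker coordinates *)

Section Pluecker.
Variables (F : fieldType) (r n : nat).
Implicit Types (t : r.-tuple 'I_n) (k l : 'I_#|{: pidx r n}|).
Implicit Types (A : 'M[F]_(n, r)) (g : 'M[F]_n).

Lemma det_row0 m (A : 'M[F]_m) i : (forall j, A i j = 0) -> \det A = 0.
Proof.
move=> A0; rewrite /determinant big1 // => s _.
by rewrite (bigD1 i) //= A0 mul0r mulr0.
Qed.

Lemma det_col0 m (A : 'M[F]_m) j : (forall i, A i j = 0) -> \det A = 0.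
Proof.
by move=> A0; rewrite -det_tr; apply: (det_row0 (i := j)) => i; rewrite mxE.
Qed.

Lemma pcoord_inj k : injective (pcoord k).
Proof.
rewrite /pcoord; case: (enum_val k) => t /= st; apply/tuple_uniqP.
have : uniq (map val t).
  by apply: sorted_uniq st; [apply: ltn_trans|apply: ltnn].
exact: map_uniq.
Qed.

Definition pindex (t : r.-tuple 'I_n) (ht : sorted ltn (map val t)) :
  'I_#|{: pidx r n}| := enum_rank (exist _ t ht : pidx r n).

Lemma pcoord_pindex (t : r.-tuple 'I_n) (ht : sorted ltn (map val t)) i :
  pcoord (pindex ht) i = tnth t i.
Proof. by rewrite /pcoord /pindex enum_rankK. Qed.

Lemma pcoord_eq k l : (forall i, exists j, pcoord k i = pcoord l j) -> k = l.
Proof.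
rewrite /pcoord => kl; apply: enum_val_inj; apply: val_inj.
move: kl; case: (enum_val k) => t st; case: (enum_val l) => u su /= tu.
apply: val_inj; apply: (inj_map val_inj).
apply: (irr_sorted_eq ltn_trans ltnn) => //.
have us s : sorted ltn s -> uniq s.
  by apply: sorted_uniq; [apply: ltn_trans|apply: ltnn].
have sub : {subset map val t <= map val u}.
  move=> _ /mapP[x /tnthP[i ->] ->].
  by have [j ->] := tu i; rewrite map_f ?mem_tnth.
have sz : (size (map val u) <= size (map val t))%N.
  by rewrite !size_map !size_tuple.
by have [_] := uniq_min_size (us _ st) sub sz.
Qed.

Lemma ext_power_diag g k l : is_diag_mx g ->
  ext_power r g k l =
  if k == l then \prod_i g (pcoord k i) (pcoord k i) else 0.
Proof.
move=> /is_diag_mxP gd; rewrite mxE; have [<-|kl] := eqVneq k l.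
  rewrite (_ : \matrix_(_, _) _ =
      diag_mx (\row_i g (pcoord k i) (pcoord k i))).
    by rewrite det_diag; apply: eq_bigr => i _; rewrite mxE.
  apply/matrixP => i j; rewrite !mxE; have [<-//|ij] := eqVneq i j.
  by rewrite gd // (inj_eq val_inj) (inj_eq (@pcoord_inj k)).
have [i hi] : exists i, forall j, pcoord k i <> pcoord l j.
  apply: contrapT => nex; move/eqP: kl; apply; apply: pcoord_eq => i.
  by apply: contrapT => nj; apply: nex; exists i => j h; apply: nj; exists j.
apply: (det_row0 (i := i)) => j; rewrite mxE gd //.
by rewrite (inj_eq val_inj); apply/eqP.
Qed.

Lemma ext_power_diagE g (u : 'cV[F]_#|{: pidx r n}|) k : is_diag_mx g ->
  (ext_power r g *m u) k 0 = (\prod_i g (pcoord k i) (pcoord k i)) * u k 0.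
Proof.
move=> gd; rewrite mxE (bigD1 k) //= big1 ?addr0.
  by rewrite ext_power_diag // eqxx.
by move=> l lk; rewrite ext_power_diag // eq_sym (negbTE lk) mul0r.
Qed.

Lemma wedge_diag g A : is_diag_mx g ->
  wedge (g *m A) = ext_power r g *m wedge A.
Proof.
move=> gd; apply/matrixP => k j; rewrite ord1 ext_power_diagE // !mxE.
rewrite (_ : \matrix_(_, _) _ = diag_mx (\row_i g (pcoord k i) (pcoord k i)) *m
    (\matrix_(i, j) A (pcoord k i) j)).
  rewrite det_mulmx det_diag; congr (_ * _).
  by apply: eq_bigr => i _; rewrite mxE.
apply/matrixP => i l; rewrite mul_diag_mx !mxE (bigD1 (pcoord k i)) //=.
rewrite big1 ?addr0 // => m mi.
move/is_diag_mxP: gd => -> //; first by rewrite mul0r.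
by rewrite (inj_eq val_inj) eq_sym.
Qed.

Lemma wedge_mulr A (h : 'M[F]_r) : wedge (A *m h) = \det h *: wedge A.
Proof.
apply/matrixP => k j; rewrite !mxE mulrC -det_mulmx; congr (\det _).
by apply/matrixP => i l; rewrite !mxE; apply: eq_bigr => m _; rewrite mxE.
Qed.

Lemma wedge_sub g (t : r.-tuple 'I_n) (ht : sorted ltn (map val t)) k :
  (ext_power r g *m wedge (\matrix_(i, j) (i == tnth t j)%:R)) k 0 =
  ext_power r g k (pindex ht).
Proof.
have d1 : is_diag_mx (1%:M : 'M[F]_n) by apply: scalar_mx_is_diag.
have wE l : wedge (\matrix_(i, j) (i == tnth t j)%:R : 'M[F]_(n, r)) l 0 =
    (l == pindex ht)%:R.
  have := @ext_power_diag 1%:M l (pindex ht) d1.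
  under eq_bigr do rewrite mxE eqxx.
  rewrite big1_eq => E.
  rewrite -[RHS](_ : (if l == pindex ht then 1 else 0) = _).
    rewrite -E !mxE; congr (\det _); apply/matrixP => i j.
    by rewrite !mxE pcoord_pindex.
  by case: eqP.
rewrite mxE (bigD1 (pindex ht)) //= big1 ?addr0 ?wE ?eqxx ?mulr1 //.
by move=> l /negbTE ln; rewrite wE ln mulr0.
Qed.

Lemma act_line_line (g : 'M[F]_n) u :
  act_line (@ext_power F r n) g <[u]> = <[ext_power r g *m u]>%VS.
Proof. by rewrite /act_line limg_line lfunE. Qed.

Lemma Horbit_wedge (H : set 'M[F]_n) g A (t : r.-tuple 'I_n) :
  sorted ltn (map val t) -> H g ->
  (forall i j, g i (tnth t j) = A i j) -> Horbit H (e_ F t) <[wedge A]>%VS.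
Proof.
move=> ht Hg gA; exists g => //; rewrite /e_ act_line_line; congr <[_]>%VS.
apply/matrixP => k j; rewrite ord1 wedge_sub !mxE; congr (\det _).
by apply/matrixP => i l; rewrite !mxE pcoord_pindex gA.
Qed.

Lemma rank_wedge A : wedge A != 0 -> \rank A = r.
Proof.
move=> A0; apply/eqP; rewrite eqn_leq rank_leq_col /=.
have [k] : exists k, wedge A k 0 != 0.
  apply: contrapT => nk; case/eqP: A0; apply/matrixP => k j.
  rewrite ord1 [RHS]mxE.
  by apply/eqP/negP => /negP h; apply: nk; exists k.
rewrite mxE -unitfE -unitmxE => /mxrank_unit rk; rewrite -[X in (X <= _)%N]rk.
rewrite (_ : \matrix_(_, _) _ = (\matrix_(i, j) (pcoord k i == j)%:R) *m A).
  exact: mxrankM_maxr.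
apply/matrixP => i j; rewrite !mxE (bigD1 (pcoord k i)) //= mxE eqxx mul1r.
rewrite big1 ?addr0 // => m; rewrite mxE eq_sym => /negbTE ->; exact: mul0r.
Qed.

Lemma pcoord_sort (f : 'I_r -> 'I_n) : injective f ->
  exists k (s : 'S_r), forall i, f i = pcoord k (s i).
Proof.
move=> fi; pose t0 := [tuple f i | i < r].
pose t1 := sort leq (map val t0).
have st1 : sorted ltn t1.
  rewrite ltn_sorted_uniq_leq sort_uniq sort_sorted ?andbT;
    last exact: leq_total.
  rewrite map_inj_uniq; last exact: val_inj.
  by rewrite map_inj_uniq // enum_uniq.
pose t2 := sort (relpre val leq) t0.
have st2 : size t2 == r by rewrite size_sort size_tuple.
have mt2 : map val (Tuple st2) = t1 by rewrite /t1 sort_map.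
have ht : sorted ltn (map val (Tuple st2)) by rewrite mt2.
exists (pindex ht).
have fex i : exists j, f i == tnth (Tuple st2) j.
  have : f i \in Tuple st2.
    by rewrite memtE /= mem_sort; apply/tnthP; exists i; rewrite tnth_mktuple.
  by move=> /tnthP[j ->]; exists j.
pose s i := xchoose (fex i).
have sE i : f i = tnth (Tuple st2) (s i).
  by apply/eqP; exact: (xchooseP (fex i)).
have si : injective s by move=> i j ij; apply: fi; rewrite !sE ij.
by exists (perm si) => i; rewrite permE pcoord_pindex.
Qed.

(** The rows of A in J have rank less than r: otherwise r of them would form an
    invertible matrix, whose determinant is a Plücker coordinate up to sign. *)
Lemma minors_ker A (J : pred 'I_n) :
  (forall k, (forall i, J (pcoord k i)) -> wedge A k 0 = 0) ->
  exists2 c : 'cV[F]_r, c != 0 & forall i, J i -> (A *m c) i 0 = 0.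
Proof.
move=> AJ; pose N : 'M[F]_(n, r) := \matrix_(i, j) if J i then A i j else 0.
have rN : ~~ row_full N.
  apply/negP => rk; have := fullrowsub_unit rk; rewrite unitmxE unitfE.
  apply/negP; rewrite negbK; have fi := @fullrankfun_inj _ _ _ _ rk.
  set f := fullrankfun rk in fi *.
  have [Jf|] := pselect (forall i, J (f i)); last first.
    move=> /existsNP[i /negP/negbTE Ji]; apply/eqP.
    apply: (det_row0 (i := i)) => j.
    by rewrite !mxE Ji.
  have [k [s fk]] := pcoord_sort fi.
  have Ak : wedge A k 0 = 0.
    by apply: AJ => i; have := Jf (s^-1 i)%g; rewrite fk permKV.
  rewrite (_ : rowsub f N = row_perm s (\matrix_(i, j) A (pcoord k i) j)).
    by move: Ak; rewrite mxE row_permE det_mulmx => ->; rewrite mulr0.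
  by apply/matrixP => i j; rewrite !mxE Jf -fk.
have : kermx N^T != 0 by rewrite kermx_eq0 /row_free mxrank_tr.
move=> /rowV0Pn[c /sub_kermxP cN c0].
exists c^T; first by apply: contraNneq c0 => cT; rewrite -(trmxK c) cT trmx0.
move=> i Ji; have := congr1 (fun M : 'rV_n => M 0 i) cN; rewrite !mxE => cE.
rewrite -[RHS]cE; by apply: eq_bigr => j _; rewrite !mxE Ji mulrC.
Qed.

End Pluecker.

(** * The Richardson variety of [1,2,5] and [3,5,7] *)

Section Richardson.
Variable F : closedFieldType.
Implicit Types (a b c u w : nat -> F) (t : nat -> F).

Local Notation idx := 'I_#|{: pidx 3 7}|.
Local Notation Lam := 'cV[F]_#|{: pidx 3 7}|.
Local Notation rows123 a := (fun i : nat => if (i < 3)%N then a i else 0).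
Local Notation rows2345 b := (fun i : nat => if (0 < i < 5)%N then b i else 0).
Local Notation rows567 c := (fun i : nat => if (3 < i)%N then c i else 0).

Lemma det3E (f : nat -> nat -> F) : \det (\matrix_(i < 3, j < 3) f i j) =
  f 0 0 * (f 1 1 * f 2 2 - f 1 2 * f 2 1)
  - f 0 1 * (f 1 0 * f 2 2 - f 1 2 * f 2 0)
  + f 0 2 * (f 1 0 * f 2 1 - f 1 1 * f 2 0).
Proof.
rewrite (expand_det_row _ ord0) !big_ord_recl big_ord0 /cofactor !mxE /=.
rewrite !(expand_det_row _ ord0) !big_ord_recl !big_ord0 /cofactor !mxE /=.
rewrite !det_mx11 !mxE /=.
by rewrite ?expr0 ?expr1 ?expr2 /bump /=; ring.
Qed.

(** Columns are functions of natural numbers, so that their values at given rows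
    compute. Rows are counted from 0 in formulas and, as in [1,2,5] and [3,5,7],
    from 1 in comments. *)
Definition cols u w c : 'M[F]_(7, 3) :=
  \matrix_(i, j) (if val j is 0 then u i else if val j is 1 then w i else c i).

Lemma wedge_cols u w c (k : idx) :
  let p i : nat := pcoord k (inord i) in
  wedge (cols u w c) k 0 =
  u (p 0) * (w (p 1) * c (p 2) - c (p 1) * w (p 2))
  - w (p 0) * (u (p 1) * c (p 2) - c (p 1) * u (p 2))
  + c (p 0) * (u (p 1) * w (p 2) - w (p 1) * u (p 2)).
Proof.
pose f (i j : nat) := let x := nat_of_ord (pcoord k (inord i)) in
  if j is 0 then u x else if j is 1 then w x else c x.
rewrite mxE (_ : \matrix_(_, _) _ = \matrix_(i < 3, j < 3) f i j).
  by rewrite det3E.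
by apply/matrixP => i j; rewrite !mxE /f inord_val.
Qed.

Definition pl x y z (h : (x < y)%N && (y < z)%N && (z < 7)%N) : idx.
Proof.
apply: (@pindex 3 7 [tuple inord x; inord y; inord z]).
abstract (move: h => /andP[/andP[xy yz] z7] /=;
  rewrite !inordK ?xy ?yz // ?(ltn_trans yz) //;
  rewrite (ltn_trans xy) ?(ltn_trans yz) //).
Defined.
Arguments pl : clear implicits.

Lemma pl_coord x y z h i : (i < 3)%N ->
  nat_of_ord (pcoord (pl x y z h) (inord i)) = nth 0%N [:: x; y; z] i.
Proof.
move=> i3; rewrite pcoord_pindex (tnth_nth ord0) /= inordK //.
move: h => /andP[/andP[xy yz] z7].
have y7 := ltn_trans yz z7; have x7 := ltn_trans xy y7.
by case: i i3 => [|[|[|//]]] _ /=; rewrite inordK.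
Qed.

Lemma wedge_pl u w c x y z h : wedge (cols u w c) (pl x y z h) 0 =
  u x * (w y * c z - c y * w z) - w x * (u y * c z - c y * u z)
  + c x * (u y * w z - w y * u z).
Proof. by rewrite wedge_cols !pl_coord. Qed.

(** The columns are supported on rows 1-3, 2-5 and 5-7; subspaces spanned by
    three such vectors are dense in the variety. *)
Definition mat a b c : 'M[F]_(7, 3) :=
  cols (rows123 a)
       (rows2345 b)
       (rows567 c).

Lemma prod7 (f : nat -> F) :
  \prod_(i < 7) f i = f 0 * f 1 * f 2 * f 3 * f 4 * f 5 * f 6.
Proof. by rewrite !big_ord_recr big_ord0 /= mul1r. Qed.

Definition dmx t : 'M[F]_7 := diag_mx (\row_i t i).

Lemma dmxE t (i : 'I_7) : dmx t i i = t i.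
Proof. by rewrite !mxE eqxx. Qed.

Lemma dmx_torus t : t 0 * t 1 * t 2 * t 3 * t 4 * t 5 * t 6 = 1 ->
  torus F 7 (dmx t).
Proof.
move=> t1; split; last exact: diag_mx_is_diag.
rewrite /SL /= det_diag -[RHS]t1 -prod7; apply: eq_bigr => i _; by rewrite mxE.
Qed.

Lemma wedge_torus t u w c :
  wedge (cols (fun i => t i * u i) (fun i => t i * w i) (fun i => t i * c i)) =
  ext_power 3 (dmx t) *m wedge (cols u w c).
Proof.
rewrite -wedge_diag ?diag_mx_is_diag //; congr wedge.
by apply/matrixP => i j; rewrite mul_diag_mx !mxE; case: (val j) => [|[]].
Qed.

Lemma wedge_colscale x y z u w c :
  wedge (cols (fun i => x * u i) (fun i => y * w i) (fun i => z * c i)) =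
  (x * y * z) *: wedge (cols u w c).
Proof. by apply/matrixP => k j; rewrite ord1 [RHS]mxE !wedge_cols; ring. Qed.

Lemma wedge_colop x z u w c :
  wedge (cols u (fun i => w i + x * u i + z * c i) c) = wedge (cols u w c).
Proof. by apply/matrixP => k j; rewrite ord1 !wedge_cols; ring. Qed.

Lemma eq_cols u w c u' w' c' :
  (forall i, (i < 7)%N -> [/\ u i = u' i, w i = w' i & c i = c' i]) ->
  cols u w c = cols u' w' c'.
Proof.
move=> e; apply/matrixP => i j; rewrite !mxE.
by have [-> -> ->] := e i (ltn_ord i).
Qed.

(** The slice: one representative of every torus orbit with no vanishing
    coordinate, up to the scaling of v. *)
Definition sliceb (v : 'cV[F]_2) (i : nat) : F :=
  if i is 1 then v 0 0 else if i is 2 then v 1 0 else 1.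

Definition slice (v : 'cV[F]_2) : Lam :=
  wedge (mat (fun=> 1) (sliceb v) (fun=> 1)).

Lemma slice_orbit a b c : (forall i, [/\ a i != 0, b i != 0 & c i != 0]) ->
  exists t x v, [/\ torus F 7 (dmx t), x != 0, v != 0 &
    wedge (mat a b c) = x *: (ext_power 3 (dmx t) *m slice v)].
Proof.
move=> nz; have a0 i : a i != 0 by case: (nz i).
have b0 i : b i != 0 by case: (nz i).
have c0 i : c i != 0 by case: (nz i).
(* Row 5 meets two columns: this is the ratio of their scalings. *)
pose z := c 4 / b 4.
have z0 : z != 0 by rewrite mulf_neq0 ?invr_eq0.
pose m := a 0 * a 1 * a 2 * b 3 * b 4 * c 5 * c 6 / z ^+ 2.
have m0 : m != 0 by rewrite !(mulf_neq0, invr_eq0, expf_neq0).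
(* The cube root gives the torus element determinant 1. *)
have [x x3] := @exists_root F m 3 isT.
have x0 : x != 0 by apply: contraNneq m0 => x0; rewrite -x3 x0 expr0n.
pose t i := if (i < 3)%N then a i / x else if (i < 5)%N then b i else c i / z.
have t0 i : t i != 0.
  rewrite /t; case: ifP => _; [|case: ifP => _];
    by rewrite ?mulf_neq0 ?invr_eq0.
exists t, (x * 1 * z), (vec2 (b 1 / t 1) (b 2 / t 2)); split.
- apply: dmx_torus; rewrite /t /=.
  rewrite (_ : _ * _ = m * z ^+ 2 / (z ^+ 2) / x ^+ 3); last first.
    by rewrite /m; field; rewrite x0 z0.
  by rewrite x3; field; rewrite m0 z0.
- by rewrite mulr1 mulf_neq0.
- by rewrite vec2_eq0 vec2_0 negb_and mulf_neq0 // invr_eq0.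
rewrite -wedge_torus -wedge_colscale; congr wedge; apply: eq_cols.
move=> i i7; rewrite /t.
case: i i7 => [|[|[|[|[|[|[|//]]]]]]] _ /=; split;
  rewrite ?vec2_0 ?vec2_1 ?mulr0 ?mulr1 ?mul1r //; rewrite /z; field;
  by rewrite ?x0 ?a0 ?b0 ?c0.
Qed.

(** With x = z^7, take the torus element with entries z^4 in rows 1-3 and z^-3
    in rows 4-7, and scale the columns back by z^-4, z^3 and z^3. The total
    factor y = z^2 satisfies y^7 = x^2, so that sections of O(7) restrict to
    forms of degree 2. *)
Lemma slice_scale x v : x != 0 -> exists t y, [/\ torus F 7 (dmx t),
  y ^+ 7 = x ^+ 2 & slice (x *: v) = y *: (ext_power 3 (dmx t) *m slice v)].
Proof.
move=> x0; have [z z7] := @exists_root F x 7 isT.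
have z0 : z != 0 by apply: contraNneq x0 => z0; rewrite -z7 z0 expr0n.
pose t i := if (i < 3)%N then z ^+ 4 else (z ^+ 3)^-1.
exists t, ((z ^+ 4)^-1 * z ^+ 3 * z ^+ 3); split.
- by apply: dmx_torus; rewrite /t /=; field.
- rewrite -z7; field; exact: z0.
rewrite -wedge_torus -wedge_colscale; congr wedge; apply: eq_cols.
move=> i i7; rewrite /t -z7.
case: i i7 => [|[|[|[|[|[|[|//]]]]]]] _ /=; split;
  rewrite ?mxE ?mulr0 ?mulr1 //; by field.
Qed.

Lemma coset_rep_s4s3 : coset_rep s4s3 = [tuple inord 0; inord 1; inord 4].
Proof.
have ne i j : (i < 7)%N -> (j < 7)%N -> i != j -> (inord i : 'I_7) != inord j.
  move=> i7 j7; apply: contra => /eqP /(congr1 val) /=.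
  by rewrite !inordK // => ->.
have E0 : s4s3 (inord 0) = inord 0.
  by rewrite /s4s3 /simple_refl permM !tpermD ?ne.
have E1 : s4s3 (inord 1) = inord 1.
  by rewrite /s4s3 /simple_refl permM !tpermD ?ne.
have E2 : s4s3 (inord 2) = inord 4.
  by rewrite /s4s3 /simple_refl permM !tpermL.
by apply: val_inj; rewrite /= E0 E1 E2.
Qed.

Lemma sorted_v : sorted ltn (map val [tuple inord 0; inord 1; inord 4 : 'I_7]).
Proof. by rewrite /= !inordK. Qed.

Lemma sorted_w : sorted ltn (map val w37).
Proof. by rewrite /= !inordK. Qed.

(** The open set where the k-th coordinate does not vanish misses the orbit,
    hence its closure. *)
Lemma zclosure_vanish (H : set 'M[F]_7) (t : 3.-tuple 'I_7)
    (ht : sorted ltn (map val t)) (u : Lam) k : u != 0 ->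
  zclosure (Gr F 3 7) (Horbit H (e_ F t)) <[u]>%VS ->
  (forall g, H g -> ext_power 3 g k (pindex ht) = 0) -> u k 0 = 0.
Proof.
move=> u0 [[_ Gu] clu] Hk; apply: contrapT => uk.
have hX := hpolyXU F k.
pose U := [set l : {vspace Lam} | pdomain ('X_k : {mpoly F[_]}) l] `&`
  [set <[wedge A]>%VS | A in [set A : 'M[F]_(7, 3) | \rank A = 3]].
have [||y [[dl [v vy vk]] _] [g Hg gy]] := clu U.
- exists (pdomain ('X_k : {mpoly F[_]})) => //; exact: pdomain_open hX.
- split=> //; split; first exact: dim_line.
  by apply/(nonvanishing_line hX u0); rewrite pevalXU.
move: vy; rewrite -gy /e_ act_line_line => /vlineP[x vE]; apply: vk.
by rewrite pevalXU vE mxE wedge_sub Hk // mulr0.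
Qed.

Local Notation X := (richardson F (coset_rep s4s3) w37).

Lemma X_vanish_low (u : Lam) k : u != 0 -> X <[u]>%VS ->
  (forall i, (2 < pcoord k i)%N) -> u k 0 = 0.
Proof.
move=> u0 [Xw _] hk; apply: (zclosure_vanish (ht := sorted_w) u0 Xw).
move=> g [_ /is_trig_mxP gt]; rewrite mxE; apply: (det_col0 (j := ord0)) => i.
have := gt (inord 2) (pcoord k i); rewrite inordK // => /(_ (hk i)).
by rewrite !mxE pcoord_pindex.
Qed.

Lemma X_vanish_high (u : Lam) k : u != 0 -> X <[u]>%VS ->
  (forall i, (pcoord k i < 4)%N) -> u k 0 = 0.
Proof.
rewrite coset_rep_s4s3.
move=> u0 [_ Xv] hk; apply: (zclosure_vanish (ht := sorted_v) u0 Xv).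
move=> g [_ /is_trig_mxP gt]; rewrite mxE.
apply: (det_col0 (j := ord_max)) => i; rewrite mxE pcoord_pindex.
by rewrite gt //= (tnth_nth ord0) /= inordK.
Qed.

Lemma X_vanish_67 (u : Lam) x h : u != 0 -> X <[u]>%VS ->
  u (pl x 5 6 h) 0 = 0.
Proof.
move=> u0 [Xw _]; apply: (zclosure_vanish (ht := sorted_w) u0 Xw).
move=> g [_ /is_trig_mxP gt]; pose f (i j : nat) :=
  g (inord (nth 0%N [:: x; 5; 6] i)) (inord (nth 0%N [:: 2; 4; 6] j)).
rewrite mxE (_ : \matrix_(_, _) _ = \matrix_(i < 3, j < 3) f i j).
  have g0 (i j : nat) : (i < 7)%N -> (j < i)%N -> g (inord i) (inord j) = 0.
    move=> i7 ji; have := gt (inord j) (inord i).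
    by rewrite mxE; apply; rewrite !inordK // (ltn_trans ji).
  by rewrite det3E /f /= (g0 5 2) ?(g0 5 4) ?(g0 6 2) ?(g0 6 4) //; ring.
apply/matrixP => i j; rewrite !mxE /f; congr (g _ _); apply: val_inj.
  have := pl_coord h (ltn_ord i); rewrite inord_val /= => ->; rewrite inordK //.
  move: h => /andP[/andP[xy _] _].
  by case: i => [[|[|[|//]]]] hi //=; rewrite (ltn_trans xy).
rewrite pcoord_pindex (tnth_nth ord0) /=.
by case: j => [[|[|[|//]]]].
Qed.

End Richardson.
Arguments pl : clear implicits.

(** * Density of the torus translates of the slice *)

Section Density.
Variable F : closedFieldType.
Implicit Types (a b c u w : nat -> F).

Local Notation Lam := 'cV[F]_#|{: pidx 3 7}|.
Local Notation rows123 a := (fun i : nat => if (i < 3)%N then a i else 0).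
Local Notation rows567 c := (fun i : nat => if (3 < i)%N then c i else 0).
Local Notation X := (richardson F (coset_rep s4s3) w37).

Lemma polyfun_cols (u w c : F -> nat -> F) k :
  (forall i, polyfun (fun z => u z i)) ->
  (forall i, polyfun (fun z => w z i)) ->
  (forall i, polyfun (fun z => c z i)) ->
  polyfun (fun z => wedge (cols (u z) (w z) (c z)) k 0).
Proof.
move=> pu pw pc.
have [P hP] : polyfun (fun z =>
    \det (\matrix_(i, j) cols (u z) (w z) (c z) (pcoord k i) j)).
  apply: polyfun_det => i j.
  have [P hP] : polyfun (fun z => cols (u z) (w z) (c z) (pcoord k i) j).
    case: j => [[|[|j]]] hj; [case: (pu (pcoord k i))|case: (pw (pcoord k i))|
      case: (pc (pcoord k i))] => P hP; by exists P => z; rewrite mxE /= hP.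
  by exists P => z; rewrite mxE hP.
by exists P => z; rewrite mxE hP.
Qed.

Lemma mat_w a b c : wedge (mat a b c) (pl 2 4 6 isT) 0 = a 2 * b 4 * c 6.
Proof. by rewrite wedge_pl /=; ring. Qed.

Lemma mat_rank a b c : a 2 != 0 -> b 4 != 0 -> c 6 != 0 ->
  wedge (mat a b c) != 0.
Proof.
move=> a2 b4 c6; apply/eqP => /matrixP /(_ (pl 2 4 6 isT) 0) /eqP.
by rewrite mat_w mxE !mulf_eq0 (negbTE a2) (negbTE b4) (negbTE c6).
Qed.

Lemma line_scale (V : vectType F) x (v : V) :
  x != 0 -> <[x *: v]>%VS = <[v]>%VS.
Proof.
move=> x0; apply/eqP; rewrite eqEsubv -!memvE; apply/andP.
split; first by rewrite memvZ ?memv_line.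
by apply/vlineP; exists x^-1; rewrite scalerA mulVf // scale1r.
Qed.

Lemma mat_scale x a b c :
  wedge (mat (fun i => x * a i) b c) = x *: wedge (mat a b c).
Proof.
have -> : x = x * 1 * 1 by rewrite !mulr1.
rewrite -wedge_colscale; congr wedge; apply: eq_cols => i _; split.
- by case: ifP; rewrite ?mulr0 // !mulr1.
- by rewrite mul1r.
- by rewrite mul1r.
Qed.

(** The columns 3, 5 and 7 of an upper triangular matrix are vectors of this
    form; scaling one of them gives the matrix determinant 1. *)
Lemma mat_schubert a b c : a 2 != 0 -> b 4 != 0 -> c 6 != 0 ->
  Horbit (@Bplus F 7) (e_ F w37) <[wedge (mat a b c)]>%VS.
Proof.
move=> a2 b4 c6; pose x := (a 2 * b 4 * c 6)^-1.
have x0 : x != 0 by rewrite invr_eq0 !mulf_neq0.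
rewrite -(line_scale _ x0) -mat_scale.
pose f (i j : nat) : F :=
  if j is 2 then (if (i < 3)%N then x * a i else 0)
  else if j is 4 then (if (0 < i < 5)%N then b i else 0)
  else if j is 6 then (if (3 < i)%N then c i else 0)
  else (i == j)%:R.
apply: (@Horbit_wedge F 3 7 (@Bplus F 7) (\matrix_(i, j) f i j)).
- exact: sorted_w.
- have tr : is_trig_mx (\matrix_(i < 7, j < 7) f i j)^T.
    apply/is_trig_mxP => i j ij; rewrite !mxE /f.
    have ji : (j == i :> nat) = false by rewrite gtn_eqF.
    case: i ij ji => [[|[|[|[|[|[|[|//]]]]]]]] hi;
      case: j => [[|[|[|[|[|[|[|//]]]]]]]] hj //.
  split=> //; rewrite /SL /= -det_tr det_trig //.
  rewrite (eq_bigr (fun i : 'I_7 => f i i)); last by move=> i _; rewrite !mxE.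
  rewrite (prod7 (fun i => f i i)) /f /= /x; field.
  by rewrite a2 b4 c6.
- move=> i j; rewrite !mxE (tnth_nth ord0) /=.
  by case: j => [[|[|[|//]]]] hj /=; rewrite inordK.
Qed.

Lemma mat_opposite a b c : a 0 != 0 -> b 1 != 0 -> c 4 != 0 ->
  Horbit (@Bminus F 7) (e_ F (coset_rep s4s3)) <[wedge (mat a b c)]>%VS.
Proof.
rewrite coset_rep_s4s3.
move=> a2 b4 c6; pose x := (a 0 * b 1 * c 4)^-1.
have x0 : x != 0 by rewrite invr_eq0 !mulf_neq0.
rewrite -(line_scale _ x0) -mat_scale.
pose f (i j : nat) : F :=
  if j is 0 then (if (i < 3)%N then x * a i else 0)
  else if j is 1 then (if (0 < i < 5)%N then b i else 0)
  else if j is 4 then (if (3 < i)%N then c i else 0)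
  else (i == j)%:R.
apply: (@Horbit_wedge F 3 7 (@Bminus F 7) (\matrix_(i, j) f i j)).
- exact: sorted_v.
- have tr : is_trig_mx (\matrix_(i < 7, j < 7) f i j).
    apply/is_trig_mxP => i j ij; rewrite !mxE /f.
    have ji : (i == j :> nat) = false by rewrite ltn_eqF.
    case: i ij ji => [[|[|[|[|[|[|[|//]]]]]]]] hi;
      case: j => [[|[|[|[|[|[|[|//]]]]]]]] hj //.
  split=> //; rewrite /SL /= det_trig //.
  rewrite (eq_bigr (fun i : 'I_7 => f i i)); last by move=> i _; rewrite !mxE.
  rewrite (prod7 (fun i => f i i)) /f /= /x; field.
  by rewrite a2 b4 c6.
- move=> i j; rewrite !mxE (tnth_nth ord0) /=.
  by case: j => [[|[|[|//]]]] hj /=; rewrite inordK.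
Qed.

(** The points with b 1 = 0 are not in the opposite cell, but are limits of the
    points with b 1 = z != 0. *)
Lemma mat_in_X a b c : a 0 != 0 -> a 2 != 0 -> b 4 != 0 -> c 4 != 0 ->
  c 6 != 0 -> X <[wedge (mat a b c)]>%VS.
Proof.
move=> a0 a2 b4 c4 c6; have u0 := mat_rank a2 b4 c6.
have Gu a' b' c' : wedge (mat a' b' c') != 0 ->
    dom (Gr F 3 7) <[wedge (mat a' b' c')]>%VS.
  move=> h; split; first exact: dim_line.
  by exists (mat a' b' c') => //=; apply: rank_wedge.
split; split; try exact: Gu.
  move=> U _ Uu; exists <[wedge (mat a b c)]>%VS => //; exact: mat_schubert.
move=> _ [W oW ->] [Wu _].
have [_ [d [p [hp pu pW]]]] := oW _ Wu.
pose bz z i := if i == 1%N then z else b i.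
have [z [pz z0]] : exists z, peval p (wedge (mat a (bz z) c)) != 0 /\ z != 0.
  apply: (@polyfun_avoid _
    (fun z => peval p (wedge (mat a (bz z) c))) id (b 1) 1).
  - apply: polyfun_peval => k; apply: polyfun_cols => i.
    + exact: polyfun_const.
    + case: (0 < i < 5)%N; last exact: polyfun_const.
      rewrite /bz; case: (i == 1)%N; [exact: polyfun_id|exact: polyfun_const].
    + exact: polyfun_const.
  - exact: polyfun_id.
  - rewrite (_ : mat a (bz (b 1)) c = mat a b c).
      by apply/eqP; have [+ _] := nonvanishing_line hp u0; apply.
    by apply: eq_cols => i _; split=> //; rewrite /bz; case: eqP => [->|].
  - exact: oner_neq0.
have uz0 : wedge (mat a (bz z) c) != 0 by apply: mat_rank.
exists <[wedge (mat a (bz z) c)]>%VS.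
  split; last by case: (Gu a (bz z) c uz0).
  by apply: pW; rewrite ?dim_line //; apply/(nonvanishing_line hp uz0)/eqP.
exact: mat_opposite.
Qed.

Lemma cols_mulr (A : 'M[F]_(7, 3)) (h : 'M[F]_3) :
  A *m h = cols (fun i => (A *m col 0 h) (inord i) 0)
    (fun i => (A *m col 1 h) (inord i) 0)
    (fun i => (A *m col (inord 2) h) (inord i) 0).
Proof.
have e (i : 'I_7) j : (A *m col j h) i 0 = (A *m h) i j.
  by rewrite !mxE; apply: eq_bigr => k _; rewrite mxE.
apply/matrixP => i j; rewrite [RHS]mxE !e !inord_val.
case: j => [[|[|[|//]]]] hj /=; congr (_ i _); apply: val_inj => //=.
by rewrite inordK.
Qed.

(** If no middle column gave a nonzero determinant, the minors of x and y would
    vanish, and y would be a multiple of x. *)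
Lemma complete3 (x y : 'cV[F]_3) d : d != 0 -> x != 0 ->
  (forall e, y <> e *: x) ->
  exists h : 'M[F]_3, [/\ col 0 h = x, col (inord 2) h = y & \det h = d].
Proof.
move=> d0 x0 yx.
pose X i := x (inord i) 0; pose Y i := y (inord i) 0.
pose H z (i j : nat) : F :=
  if j is 0 then X i else if j is 1 then z i else Y i.
have [[z]|nz] := pselect (exists z,
    \det (\matrix_(i < 3, j < 3) H z i j) != 0).
  set D := \det _ => D0.
  exists (\matrix_(i < 3, j < 3) H (fun i => d / D * z i) i j); split.
  - by apply/matrixP => i j; rewrite ord1 !mxE /H /X inord_val.
  - by apply/matrixP => i j; rewrite ord1 !mxE inordK // /H /Y inord_val.
  - rewrite -[RHS](divfK D0); move: (d / D) => e.
    by rewrite /D !det3E /H /=; ring.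
exfalso.
have XY z : \det (\matrix_(i < 3, j < 3) H z i j) = 0.
  by apply/eqP/negP => /negP h; apply: nz; exists z.
have E01 : X 0 * Y 1 = X 1 * Y 0.
  have := XY (fun i => (i == 2)%:R); rewrite det3E /H /= => h.
  by apply/eqP; rewrite -subr_eq0 -oppr_eq0 -h; apply/eqP; ring.
have E02 : X 0 * Y 2 = X 2 * Y 0.
  have := XY (fun i => (i == 1)%:R); rewrite det3E /H /= => h.
  by apply/eqP; rewrite -subr_eq0 -h; apply/eqP; ring.
have E12 : X 1 * Y 2 = X 2 * Y 1.
  have := XY (fun i => (i == 0)%:R); rewrite det3E /H /= => h.
  by apply/eqP; rewrite -subr_eq0 -oppr_eq0 -h; apply/eqP; ring.
have [i Xi] : exists i, x i 0 != 0.
  apply: contrapT => ni; case/eqP: x0; apply/matrixP => i j.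
  rewrite ord1 [RHS]mxE.
  by apply/eqP/negP => /negP h; apply: ni; exists i.
apply: (yx (y i 0 / x i 0)); apply/matrixP => j k; rewrite ord1 !mxE.
apply: (mulfI Xi); rewrite [RHS](_ : _ = y i 0 * x j 0); last by field.
suff : X i * Y j = X j * Y i by rewrite /X /Y !inord_val [RHS]mulrC.
case: (i) (j) => [[|[|[|//]]] hi] [[|[|[|//]]] hj] //=; exact: mulrC.
Qed.

Lemma mulmx_inj0 (A : 'M[F]_(7, 3)) (x : 'cV[F]_3) : wedge A != 0 ->
  (forall i, (A *m x) i 0 = 0) -> x = 0.
Proof.
move=> A0 Ax; have : row_full A by rewrite /row_full rank_wedge.
move=> /row_fullP[B BA]; rewrite -[x]mul1mx -BA -mulmxA.
rewrite (_ : A *m x = 0) ?mulmx0 //.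
by apply/matrixP => i j; rewrite ord1 Ax mxE.
Qed.

(** The coordinates that vanish on the variety provide a vector supported on
    rows 1-3 and one supported on rows 5-7. A third vector w completes them to a
    basis; it is normalized so that u is the wedge product itself, not only up
    to a factor. The last equation comes from the coordinates [x,6,7]. *)
Lemma X_adapted_basis (u : Lam) : u != 0 -> X <[u]>%VS -> exists a w c,
  u = wedge (cols (rows123 a) w (rows567 c)) /\
  w 5 * c 6 = w 6 * c 5.
Proof.
move=> u0 Xu; have [[[_ [A _ Au]] _] _] := Xu.
have [d uE] : exists d, u = d *: wedge A.
  by apply/vlineP; rewrite Au memv_line.
have d0 : d != 0 by apply: contraNneq u0 => d0; rewrite uE d0 scale0r.
have A0 : wedge A != 0 by apply: contraNneq u0 => A0; rewrite uE A0 scaler0.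
have uA k : u k 0 = 0 -> wedge A k 0 = 0.
  by rewrite uE mxE => /eqP; rewrite mulf_eq0 (negbTE d0) => /eqP.
have [x x0 Ax] := @minors_ker F 3 7 A (fun i => 2 < i)%N
  (fun k hk => uA k (X_vanish_low u0 Xu hk)).
have [y y0 Ay] := @minors_ker F 3 7 A (fun i => i < 4)%N
  (fun k hk => uA k (X_vanish_high u0 Xu hk)).
have yx e : y <> e *: x.
  move=> ye; case/eqP: y0; apply: (mulmx_inj0 A0) => i.
  have [i4|i4] := ltnP i 4; first exact: Ay.
  by rewrite ye -scalemxAr mxE Ax ?mulr0 // (ltn_trans _ i4).
have [h [hx hy hd]] := complete3 d0 x0 yx.
have uh : u = wedge (A *m h) by rewrite wedge_mulr hd.
rewrite cols_mulr hx hy in uh.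
set w := (fun i : nat => (A *m col 1 h) (inord i) 0) in uh.
pose a i := (A *m x) (inord i) 0; pose c i := (A *m y) (inord i) 0.
exists a, w, c.
have {}uh : u = wedge (cols (rows123 a) w (rows567 c)).
  rewrite uh; congr wedge; apply: eq_cols => i i7; split=> //.
    by case: ltnP => // i3; rewrite Ax // inordK.
  by case: ltnP => // i3; rewrite Ay // inordK.
split=> //.
have [i [i3 ai]] : exists i, (i < 3)%N /\ a i != 0.
  apply: contrapT => ni; case/eqP: x0; apply: (mulmx_inj0 A0) => i.
  have [i3|i3] := ltnP i 3; last exact: Ax.
  apply/eqP/negP => /negP h'; apply: ni; exists i.
  by rewrite /a inord_val.
have h56 : (i < 5)%N && (5 < 6)%N && (6 < 7)%N by rewrite (ltn_trans i3).
have := X_vanish_67 h56 u0 Xu; rewrite {1}uh wedge_pl /= i3.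
have -> : (3 < i)%N = false by rewrite ltnNge ltnW.
rewrite !(mulr0, mul0r, subr0, addr0) => /eqP.
by rewrite mulf_eq0 (negbTE ai) /= subr_eq0 [c 5 * _]mulrC => /eqP.
Qed.

(** Moving the third vector in the direction of the entries of w in rows 6 and 7
    makes these entries proportional to its own without leaving the open set
    where p does not vanish; then they can be subtracted from w. *)
Lemma clear_rows67 a w c (p : {mpoly F[#|{: pidx 3 7}|]}) :
  w 5 * c 6 = w 6 * c 5 ->
  peval p (wedge (cols (rows123 a) w (rows567 c))) != 0 ->
  exists w' c', [/\ w' 5 = 0, w' 6 = 0 &
    peval p (wedge (cols (rows123 a) w' (rows567 c'))) != 0].
Proof.
move=> wc pu.
have red c' m : peval p (wedge (cols (rows123 a) w (rows567 c'))) != 0 ->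
    w 5 = m * c' 5 -> w 6 = m * c' 6 ->
    exists w' c', [/\ w' 5 = 0, w' 6 = 0 &
      peval p (wedge (cols (rows123 a) w' (rows567 c'))) != 0].
  move=> pc w5 w6.
  exists (fun i => w i + 0 * rows123 a i + (- m) * rows567 c' i), c'.
  by rewrite wedge_colop /= w5 w6; split=> //; ring.
have [|nw] := boolP ((w 5 == 0) && (w 6 == 0)).
  by move=> /andP[/eqP w5 /eqP w6]; apply: (red c 0); rewrite ?mul0r.
have [l [c5 c6]] : exists l, c 5 = l * w 5 /\ c 6 = l * w 6.
  move: nw; rewrite negb_and => /orP[wi|wi].
    exists (c 5 / w 5); split; first by rewrite divfK.
    by apply: (mulfI wi); rewrite wc; field.
  exists (c 6 / w 6); split; last by rewrite divfK.
  by apply: (mulfI wi); rewrite -wc; field.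
pose cz z i := c i + z * (if (4 < i)%N then w i else 0).
have [z [pz z0]] : exists z,
    peval p (wedge (cols (rows123 a) w (rows567 (cz z)))) != 0 /\ l + z != 0.
  apply: (@polyfun_avoid _ _ (fun z => l + z) 0 (1 - l)).
  - apply: polyfun_peval => k.
    apply: polyfun_cols => i; try exact: polyfun_const.
    case: (3 < i)%N; last exact: polyfun_const.
    apply: polyfunD; first exact: polyfun_const.
    by apply: polyfunM; [exact: polyfun_id|exact: polyfun_const].
  - by apply: polyfunD; [exact: polyfun_const|exact: polyfun_id].
  - move: pu; congr (peval p (wedge _) != 0).
    by apply: eq_cols => i _; rewrite /cz mul0r addr0.
  - by rewrite addrCA subrr addr0 oner_neq0.
by apply: (red (cz z) (l + z)^-1 pz); rewrite /cz /= ?c5 ?c6; field.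
Qed.

(** The same in row 1, with the first vector. *)
Lemma clear_row1 a w c (p : {mpoly F[#|{: pidx 3 7}|]}) :
  w 5 = 0 -> w 6 = 0 ->
  peval p (wedge (cols (rows123 a) w (rows567 c))) != 0 ->
  exists a' w', [/\ w' 5 = 0, w' 6 = 0, w' 0 = 0 &
    peval p (wedge (cols (rows123 a') w' (rows567 c))) != 0].
Proof.
move=> w5 w6 pw; pose az z i := a i + z * (i == 0)%:R.
have [z [pz z0]] : exists z,
    peval p (wedge (cols (rows123 (az z)) w (rows567 c))) != 0 /\ a 0 + z != 0.
  apply: (@polyfun_avoid _ _ (fun z => a 0 + z) 0 (1 - a 0)).
  - apply: polyfun_peval => k.
    apply: polyfun_cols => i; try exact: polyfun_const.
    case: (i < 3)%N; last exact: polyfun_const.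
    apply: polyfunD; first exact: polyfun_const.
    by apply: polyfunM; [exact: polyfun_id|exact: polyfun_const].
  - by apply: polyfunD; [exact: polyfun_const|exact: polyfun_id].
  - move: pw; congr (peval p (wedge _) != 0).
    by apply: eq_cols => i _; rewrite /az mul0r addr0.
  - by rewrite addrCA subrr addr0 oner_neq0.
exists (az z), (fun i => w i + (- w 0 / (a 0 + z)) * rows123 (az z) i
  + 0 * rows567 c i).
rewrite wedge_colop /= w5 w6 /az /=; split=> //; try by ring.
by field.
Qed.

(** Once the second vector lies in rows 2-5, the straight line towards the
    matrix whose entries are 1 moves all coordinates off zero. *)
Lemma density (u : Lam) (p : {mpoly F[#|{: pidx 3 7}|]}) :
  u != 0 -> X <[u]>%VS -> peval p u != 0 ->
  exists a b c, (forall i, [/\ a i != 0, b i != 0 & c i != 0]) /\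
    peval p (wedge (mat a b c)) != 0.
Proof.
move=> u0 Xu pu; have [a [w [c [uE wc]]]] := X_adapted_basis u0 Xu.
rewrite uE in pu; have [w1 [c1 [w15 w16 p1]]] := clear_rows67 wc pu.
have [a2 [w2 [w25 w26 w20 p2]]] := clear_row1 w15 w16 p1.
pose az z i := a2 i + z * (1 - a2 i); pose bz z i := w2 i + z * (1 - w2 i).
pose cz z i := c1 i + z * (1 - c1 i).
pose nz z := \prod_(i <- iota 0 7) (az z i * bz z i * cz z i).
have paff (x : F) : polyfun (fun z => x + z * (1 - x)).
  apply: polyfunD; first exact: polyfun_const.
  by apply: polyfunM; [exact: polyfun_id|exact: polyfun_const].
have [z [pz z0]] : exists z,
    peval p (wedge (mat (az z) (bz z) (cz z))) != 0 /\ nz z != 0.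
  apply: (@polyfun_avoid _ _ nz 0 1).
  - apply: polyfun_peval => k; apply: polyfun_cols => i.
    + by case: (i < 3)%N; [exact: paff|exact: polyfun_const].
    + by case: (0 < i < 5)%N; [exact: paff|exact: polyfun_const].
    + by case: (3 < i)%N; [exact: paff|exact: polyfun_const].
  - apply: polyfun_prod => i.
    by apply: polyfunM; [apply: polyfunM|]; exact: paff.
  - move: p2; congr (peval p (wedge _) != 0).
    apply: eq_cols => i i7; rewrite /az /bz /cz !mul0r !addr0; split=> //.
    by case: i i7 => [|[|[|[|[|[|[|//]]]]]]].
  - rewrite /nz big1 ?oner_neq0 // => i _; rewrite /az /bz /cz !mul1r.
    by rewrite ![_ + (1 - _)]addrCA !subrr !addr0 !mulr1.
pose r (f : nat -> F) i := if (i < 7)%N then f i else 1.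
exists (r (az z)), (r (bz z)), (r (cz z)); split.
  move=> i; rewrite /r; case: ltnP => i7; last by rewrite oner_neq0.
  move: z0; rewrite /nz prodf_seq_neq0 => /allP /(_ i).
  rewrite mem_iota /= => /(_ i7) /=; rewrite !mulf_eq0 !negb_or.
  by move=> /andP[/andP[-> ->] ->].
move: pz; congr (peval p (wedge _) != 0).
by apply: eq_cols => i i7; rewrite /r i7.
Qed.

End Density.

(** * The ring of torus-invariant sections *)

(** Written in lowest terms all local quotients agree, so that their common
    denominator has no root and is a constant. *)
Lemma local_polyfun (F : closedFieldType) (g : F -> F) :
  (forall z0, exists P Q : {poly F}, Q.[z0] != 0 /\
     forall z, Q.[z] != 0 -> g z = P.[z] / Q.[z]) -> polyfun g.
Proof.
move=> hg; have [P [Q [Q0 gPQ]]] := hg 0.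
have nQ : Q != 0 by apply: contraNneq Q0 => ->; rewrite horner0.
pose D := gcdp P Q.
have D0 : D != 0 by rewrite gcdp_eq0 negb_and nQ orbT.
pose P1 := P %/ D; pose Q1 := Q %/ D.
have PE : P = P1 * D by rewrite divpK // dvdp_gcdl.
have QE : Q = Q1 * D by rewrite divpK // dvdp_gcdr.
have cop : coprimep Q1 P1.
  by rewrite coprimep_sym; apply: coprimep_div_gcd; rewrite nQ orbT.
have eqQ z0 P' Q' : Q'.[z0] != 0 -> (forall z, Q'.[z] != 0 ->
    g z = P'.[z] / Q'.[z]) -> P1 * Q' = P' * Q1.
  move=> Q'0 gE; have nQ' : Q' != 0.
    by apply: contraNneq Q'0 => ->; rewrite horner0.
  apply: (mulIf D0); rewrite mulrAC -PE -[RHS]mulrA -QE.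
  apply/eqP; rewrite -subr_eq0; apply/negP => /negP ne.
  have : (P * Q' - P' * Q) * (Q * Q') != 0 by rewrite !mulf_neq0.
  move=> /closed_nonrootP[z]; rewrite /root hornerM mulf_eq0 negb_or.
  rewrite [(Q * Q').[z]]hornerM mulf_eq0 negb_or => /andP[ne' /andP[Qz Q'z]].
  case/eqP: ne'; rewrite hornerD hornerN !hornerM.
  have : P.[z] / Q.[z] = P'.[z] / Q'.[z] by rewrite -gPQ // -gE.
  by move=> /eqP; rewrite eqr_div // => /eqP ->; rewrite subrr.
have Q1r z0 : Q1.[z0] != 0.
  have [P' [Q' [Q'0 gE]]] := hg z0.
  have : Q1 %| Q'.
    by rewrite -(Gauss_dvdpr _ cop) (eqQ _ _ _ Q'0 gE) dvdp_mulIr.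
  move=> /dvdpP[e Q'E]; apply: contraNneq Q'0.
  by rewrite Q'E hornerM => ->; rewrite mulr0.
have sz : size Q1 = 1%N.
  apply/eqP; apply: contraT => /closed_rootP[z].
  by rewrite rootE (negbTE (Q1r z)).
have [e e0 Q1E] : exists2 e, e != 0 & Q1 = e%:P by apply/size_poly1P/eqP.
exists (e^-1 *: P1) => z.
have [P' [Q' [Q'0 gE]]] := hg z; rewrite hornerZ gE //.
have := congr1 (horner^~ z) (eqQ _ _ _ Q'0 gE).
rewrite /= !hornerM Q1E hornerC => E.
have -> : P'.[z] = P1.[z] * Q'.[z] / e by rewrite E mulfK.
by field; rewrite e0 Q'0.
Qed.

Section Invariants.
Variable F : closedFieldType.

Local Notation Lam := 'cV[F]_#|{: pidx 3 7}|.
Local Notation X := (richardson F (coset_rep s4s3) w37).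
Local Notation T := (torus F 7).
Local Notation rho := (@ext_power F 3 7).
Implicit Types (u v : Lam) (p : {mpoly F[#|{: pidx 3 7}|]}).

Lemma torus_dmx t : T t -> exists2 f : nat -> F, t = dmx f &
  f 0 * f 1 * f 2 * f 3 * f 4 * f 5 * f 6 = 1.
Proof.
move=> [t1 td]; pose f (i : nat) : F := t (inord i) (inord i).
have tE : t = dmx f.
  apply/matrixP => i j; rewrite !mxE /f inord_val.
  have [<-//|ij] := eqVneq i j.
  by move/is_diag_mxP: td => ->; rewrite // (inj_eq val_inj).
exists f => //; rewrite -prod7 -[RHS]t1 tE det_diag.
by apply: eq_bigr => i _; rewrite mxE.
Qed.

Lemma dmxV (f : nat -> F) : f 0 * f 1 * f 2 * f 3 * f 4 * f 5 * f 6 = 1 ->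
  invmx (dmx f) = dmx (fun i => (f i)^-1).
Proof.
move=> f1; have f0 (i : 'I_7) : f i != 0.
  apply/eqP => fi; have /eqP := f1; rewrite -prod7 (bigD1 i) //= fi mul0r.
  by rewrite eq_sym oner_eq0.
have e : dmx (fun i => (f i)^-1) *m dmx f = 1%:M.
  rewrite mulmx_diag -(diag_const_mx); congr diag_mx.
  by apply/matrixP => i j; rewrite !mxE mulVf.
have [_ u] := mulmx1_unit e.
by rewrite -[RHS]mulmx1 -(mulmxV u) mulmxA e mul1mx.
Qed.

Lemma torusV t : T t -> T (invmx t).
Proof.
move=> /torus_dmx[f -> f1]; rewrite dmxV //; apply: dmx_torus.
by rewrite -!invfM f1 invr1.
Qed.

Lemma rho_dmx (f : nat -> F) u k : (rho (dmx f) *m u) k 0 =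
  (\prod_i f (pcoord k i)) * u k 0.
Proof.
rewrite ext_power_diagE ?diag_mx_is_diag //; congr (_ * _).
by apply: eq_bigr => i _; rewrite dmxE.
Qed.

Lemma rhoK t u : T t -> rho (invmx t) *m (rho t *m u) = u.
Proof.
move=> /torus_dmx[f -> f1]; rewrite dmxV //; apply/matrixP => k j.
rewrite ord1 !rho_dmx mulrA -big_split /= big1 ?mul1r // => i _.
rewrite mulVf //; apply/eqP => fi; have /eqP := f1.
by rewrite -prod7 (bigD1 (pcoord k i)) //= fi mul0r eq_sym oner_eq0.
Qed.

Lemma rhoVK t u : T t -> rho t *m (rho (invmx t) *m u) = u.
Proof.
move=> Tt; have := rhoK u (torusV Tt); rewrite invmxK //.
Qed.

Lemma rho_eq0 t u : T t -> (rho t *m u == 0) = (u == 0).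
Proof.
move=> Tt; apply/eqP/eqP => [h|->]; last by rewrite mulmx0.
by rewrite -(rhoK u Tt) h mulmx0.
Qed.

Lemma mem_act_line t u (l : {vspace Lam}) : T t ->
  (u \in act_line rho t l) = (rho (invmx t) *m u \in l).
Proof.
move=> Tt; apply/memv_imgP/idP => [[v vl ->]|h].
  by rewrite lfunE /= rhoK.
by exists (rho (invmx t) *m u); rewrite // lfunE /= rhoVK.
Qed.

Definition torus_inv p : Prop := forall t, T t -> forall u,
  peval p (rho t *m u) = peval p u.

Lemma psec_act p t l : torus_inv p -> T t ->
  psec p (act_line rho t l) = act_fib rho t (psec p l).
Proof.
move=> pT Tt; apply: funext => u; rewrite /psec /act_fib mem_act_line //.
by rewrite (rho_eq0 _ (torusV Tt)) (pT _ (torusV Tt)).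
Qed.

(** Extended by zero off the cone over the variety, as are the functions that
    encode invariant sections. *)
Definition cut p : Lam -> F^o :=
  fun u => if `[< dom (var X) <[u]>%VS >] then peval p u else 0.

Lemma cutE p u : dom (var X) <[u]>%VS -> cut p u = peval p u.
Proof. by move=> h; rewrite /cut asboolT. Qed.

Lemma var_neq0 u : dom (var X) <[u]>%VS -> u != 0.
Proof. by move=> [] /= + _; rewrite dim_vline; case: eqP. Qed.

Lemma cut_inv k p : hpoly k p -> torus_inv p -> inv_sections T rho X k (cut p).
Proof.
move=> hp pT; exists (psec p); split.
- move=> l dl.
  exists (dom (var X)), (dom (proj_space F _)), (fun=> 1), (psec p).
  have op : is_open (proj_space F #|{: pidx 3 7}|) (dom (proj_space F _)).
    move=> l' dl'; split=> //; exists 0%N, 1%:MP; split=> //.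
      exact: hpolyC.
    exact: nonvanishing1.
  split=> //.
  + by split=> //; exists (dom (proj_space F _)).
  + by split=> // y [].
  + move=> y [dy _]; exists (dom (proj_space F _)), (fun=> 1); split=> //.
    exact: regular1 (proj_space_ringed _ _) _ op.
  + move=> l' dl'; split.
      move=> v nv; rewrite /psec.
      by case: ifP => // /andP[vl /eqP v0]; case: nv.
    exists 0%N, p, 1%:MP; split=> //; [exact: hpolyC|exact: nonvanishing1|].
    by move=> l2 v _ _ vl /eqP v0; rewrite pevalC divr1 /psec vl v0.
  + by move=> y _; rewrite scale1r.
- by move=> t l Tt _; apply: psec_act.
- move=> v dv; rewrite cutE // /psec memv_line var_neq0 //.
- by move=> v dv; rewrite /cut asboolF.
Qed.

Lemma section_quotient k s : sec (O_on X k) (dom (var X)) s ->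
  forall l, dom (var X) l -> exists d P Q,
    [/\ hpoly (d + k) P, hpoly d Q, nonvanishing (peval Q) l &
      forall y u, dom (var X) y -> u \in y -> u != 0 -> peval Q u != 0 ->
        s y u = peval P u / peval Q u].
Proof.
move=> ss l dl.
have [U [W [h [w [[[W0 oW0 UE] oW] [Ul Ud UW] rh sw hs]]]]] := ss l dl.
have [W1 [h' [oW1 W1l rh' hh']]] := rh l Ul.
have [d1 [a1 [b1 [ha1 hb1 b1l e1]]]] := rh' l W1l.
have [_ [d2 [a2 [b2 [ha2 hb2 b2l e2]]]]] := sw l (UW l Ul).
have [dl1 [d3 [q3 [hq3 q3l q3W]]]] : \dim l = 1%N /\ exists d p,
    [/\ hpoly d p, nonvanishing (peval p) l &
      forall l', \dim l' = 1%N -> nonvanishing (peval p) l' -> W0 l'].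
  by apply: oW0; move: Ul; rewrite UE => -[].
have [_ [d4 [q4 [hq4 q4l q4W]]]] := oW1 l W1l.
have hq := hpolyM hq3 hq4; have hb := hpolyM hb1 hb2; have ha := hpolyM ha1 ha2.
(* Multiplying by q3 and q4, which vanish off the open sets on which the
   local data are given, makes the formula valid wherever Q does not vanish. *)
exists (d3 + d4 + (d1 + d2))%N, (q3 * q4 * (a1 * a2)), (q3 * q4 * (b1 * b2)).
split.
- by have := hpolyM hq ha; rewrite !addnA.
- exact: hpolyM.
- apply/(nonvanishingM hq hb dl1); split.
    exact/(nonvanishingM hq3 hq4 dl1).
  exact/(nonvanishingM hb1 hb2 dl1).
move=> y u [dy Xy] uy u0; rewrite !pevalM !mulf_eq0 !negb_or.
move=> /andP[/andP[q3u q4u] /andP[b1u b2u]].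
have at_y d p : hpoly d p -> peval p u != 0 -> nonvanishing (peval p) y.
  by move=> hp pu; apply/(nonvanishing_at hp dy uy u0)/eqP.
have Uy : U y.
  by rewrite UE; split=> //; apply: q3W => //; apply: (at_y _ _ hq3).
have W1y : W1 y by apply: q4W => //; apply: (at_y _ _ hq4).
have {}hs : s y u = h y * w y u by rewrite hs.
rewrite hs hh' // (e1 y u) //; [|exact: (at_y _ _ hb1)|exact/eqP].
rewrite (e2 y u) //; [|exact: UW|exact: (at_y _ _ hb2)|exact/eqP].
by field; rewrite q3u q4u b1u b2u.
Qed.

Lemma inv_quotient k f : inv_sections T rho X k f ->
  forall u, dom (var X) <[u]>%VS -> exists d P Q,
    [/\ hpoly (d + k) P, hpoly d Q, peval Q u != 0 &
      forall v, dom (var X) <[v]>%VS -> peval Q v != 0 ->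
        f v = peval P v / peval Q v].
Proof.
move=> [s [ss _ fs _]] u du.
have [d [P [Q [hP hQ Qu sE]]]] := section_quotient ss du.
exists d, P, Q; split=> //.
  by apply/eqP/(nonvanishing_line hQ (var_neq0 du)).
by move=> v dv Qv; rewrite fs // sE ?memv_line ?var_neq0.
Qed.

Lemma inv_scale k f x u : inv_sections T rho X k f -> x != 0 ->
  dom (var X) <[u]>%VS -> f (x *: u) = x ^+ k * f u.
Proof.
move=> hf x0 du; have [d [P [Q [hP hQ Qu fE]]]] := inv_quotient hf du.
have Qxu : peval Q (x *: u) != 0.
  by rewrite (peval_scale _ _ hQ) mulf_neq0 // expf_neq0.
rewrite !fE ?line_scale // (peval_scale _ _ hP) (peval_scale _ _ hQ) exprD.
by field; rewrite Qu expf_neq0.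
Qed.

Lemma inv_torus k f t u : inv_sections T rho X k f -> T t ->
  dom (var X) <[u]>%VS -> dom (var X) <[rho t *m u]>%VS ->
  f (rho t *m u) = f u.
Proof.
move=> [s [_ sT fs _]] Tt du dtu.
by rewrite !fs // -act_line_line sT // /act_fib rhoK.
Qed.

Lemma mat_dom a b c : a 0 != 0 -> a 2 != 0 -> b 4 != 0 -> c 4 != 0 ->
  c 6 != 0 -> dom (var X) <[wedge (mat a b c)]>%VS.
Proof.
move=> a0 a2 b4 c4 c6; split; first exact/dim_line/mat_rank.
exact: mat_in_X.
Qed.

Lemma slice_dom (v : 'cV[F]_2) : dom (var X) <[slice v]>%VS.
Proof. by apply: mat_dom; rewrite oner_neq0. Qed.

Lemma slice_polyfun (v : F -> 'cV[F]_2) :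
  (forall i, polyfun (fun z => v z i 0)) ->
  forall k, polyfun (fun z => slice (v z) k 0).
Proof.
move=> pv k; apply: polyfun_cols => i; try exact: polyfun_const.
case: (0 < i < 5)%N; last exact: polyfun_const.
by case: i => [|[|[|i]]]; try exact: polyfun_const; apply: pv.
Qed.

(** On the two affine lines (x, 1) and (1, y) of the slice, f is locally a
    quotient of polynomials. *)
Lemma inv_form m f : inv_sections T rho X (m * 7) f ->
  exists2 p, hpoly m.*2 p &
    forall v : 'cV[F]_2, v != 0 -> f (slice v) = peval p v.
Proof.
move=> hf.
have pf (v : F -> 'cV[F]_2) : (forall i, polyfun (fun z => v z i 0)) ->
    polyfun (fun z => f (slice (v z))).
  move=> pv; apply: local_polyfun => z0.
  have [d [P [Q [_ _ Qz fE]]]] := inv_quotient hf (slice_dom (v z0)).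
  have [P' PE] := polyfun_peval P (slice_polyfun pv).
  have [Q' QE] := polyfun_peval Q (slice_polyfun pv).
  exists P', Q'; rewrite -QE; split=> // z; rewrite -QE -PE => Qz'.
  by apply: fE => //; apply: slice_dom.
apply: binary_form => [x v x0 v0||].
- have [t [y [Tt y7 vE]]] := slice_scale v x0.
  have y0 : y != 0.
    apply/eqP => yz; have /eqP := y7.
    by rewrite yz expr0n eq_sym expf_eq0 (negbTE x0).
  have dt : dom (var X) <[rho (dmx t) *m slice v]>%VS.
    by have := slice_dom (x *: v); rewrite vE line_scale.
  rewrite vE (inv_scale hf) // (inv_torus hf) //; last exact: slice_dom.
  by rewrite mulnC exprM y7 -exprM mul2n.
- apply: pf => i; have [->|i0] := eqVneq i 0.
    by exists 'X => z; rewrite vec2_0 hornerX.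
  by exists 1 => z; rewrite mxE (negbTE i0) hornerC.
- apply: pf => i; have [->|i0] := eqVneq i 0.
    by exists 1 => z; rewrite vec2_0 hornerC.
  by exists 'X => z; rewrite mxE (negbTE i0) hornerX.
Qed.

(** Both sides agree on the torus translates of the slice, up to scaling, and
    these are dense: where f is P / Q, the polynomial Q (P - p Q) vanishes on
    them. *)
Lemma inv_cut k f p : inv_sections T rho X k f -> hpoly k p -> torus_inv p ->
  (forall v : 'cV[F]_2, v != 0 -> f (slice v) = peval p (slice v)) -> f = cut p.
Proof.
move=> hf hp pT fp; apply: funext => u.
have [du|ndu] := pselect (dom (var X) <[u]>%VS); last first.
  by rewrite /cut asboolF //; case: hf => s [_ _ _ ->].
have [d [P [Q [hP hQ Qu fE]]]] := inv_quotient hf du.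
rewrite cutE // fE //; apply: (mulIf Qu); rewrite divfK //.
apply/eqP; rewrite -subr_eq0; apply/negP => /negP ne.
have [|a [b [c [nz]]]] :=
  @density F u (Q * (P + (-1) *: (p * Q))) (var_neq0 du) du.2.
  by rewrite pevalM pevalD pevalZ pevalM mulN1r mulf_neq0.
have [t [x [v [Tt x0 v0 yE]]]] := slice_orbit nz.
have dy : dom (var X) <[wedge (mat a b c)]>%VS.
  by apply: mat_dom; [case: (nz 0%N)|case: (nz 2%N)|case: (nz 4%N)|
    case: (nz 4%N)|case: (nz 6%N)].
have dt : dom (var X) <[rho (dmx t) *m slice v]>%VS.
  by move: dy; rewrite yE line_scale.
rewrite pevalM mulf_eq0 negb_or => /andP[Qy].
rewrite pevalD pevalZ pevalM mulN1r subr_eq0 => /eqP; apply.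
have fy := fE _ dy Qy; rewrite -[LHS](divfK Qy) -fy; congr (_ * _).
rewrite yE (inv_scale hf) // (inv_torus hf) //; last exact: slice_dom.
by rewrite fp // (peval_scale _ _ hp) pT.
Qed.

(** * Explicit invariants *)

Local Notation pv x y z := ('X_(pl x y z isT) : {mpoly F[#|{: pidx 3 7}|]}).

(** Every index from 1 to 7 occurs three times in each of these monomials, so
    that they are invariant; on the slice they are the squares of the two
    coordinates and their product. *)
Definition F00 :=
  pv 0 1 4 * pv 0 1 5 * pv 0 3 5 * pv 1 3 5
  * pv 2 3 6 * pv 2 4 6 * pv 2 4 6.
Definition F01 :=
  pv 0 1 4 * pv 0 2 5 * pv 0 3 5 * pv 1 3 5
  * pv 1 3 6 * pv 2 4 6 * pv 2 4 6.
Definition F11 :=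
  pv 0 2 4 * pv 0 2 5 * pv 0 3 5 * pv 1 3 5
  * pv 1 3 6 * pv 1 4 6 * pv 2 4 6.

Lemma hpoly7 (p1 p2 p3 p4 p5 p6 p7 : {mpoly F[#|{: pidx 3 7}|]}) :
  hpoly 1 p1 -> hpoly 1 p2 -> hpoly 1 p3 -> hpoly 1 p4 -> hpoly 1 p5 ->
  hpoly 1 p6 -> hpoly 1 p7 -> hpoly 7 (p1 * p2 * p3 * p4 * p5 * p6 * p7).
Proof.
move=> h1 h2 h3 h4 h5 h6 h7.
exact: (hpolyM (hpolyM (hpolyM (hpolyM (hpolyM (hpolyM
  h1 h2) h3) h4) h5) h6) h7).
Qed.

Lemma F00_hpoly : hpoly 7 F00.
Proof. by apply: hpoly7; apply: hpolyXU. Qed.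
Lemma F01_hpoly : hpoly 7 F01.
Proof. by apply: hpoly7; apply: hpolyXU. Qed.
Lemma F11_hpoly : hpoly 7 F11.
Proof. by apply: hpoly7; apply: hpolyXU. Qed.

Lemma pv_dmx (f : nat -> F) u x y z h :
  peval 'X_(pl x y z h) (rho (dmx f) *m u) =
  f x * f y * f z * peval 'X_(pl x y z h) u.
Proof.
rewrite !pevalXU rho_dmx; congr (_ * _).
rewrite (eq_bigr (fun i : 'I_3 => f (nth 0%N [:: x; y; z] i))).
  by rewrite !big_ord_recr big_ord0 /= mul1r.
by move=> i _; have := pl_coord h (ltn_ord i); rewrite inord_val => ->.
Qed.

Lemma F00_inv : torus_inv F00.
Proof.
move=> t /torus_dmx[f -> f1] u; rewrite /F00 !pevalM !pv_dmx.
rewrite -[RHS]mul1r -[1 in RHS](expr1n _ 3) -[in RHS]f1; ring.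
Qed.

Lemma F01_inv : torus_inv F01.
Proof.
move=> t /torus_dmx[f -> f1] u; rewrite /F01 !pevalM !pv_dmx.
rewrite -[RHS]mul1r -[1 in RHS](expr1n _ 3) -[in RHS]f1; ring.
Qed.

Lemma F11_inv : torus_inv F11.
Proof.
move=> t /torus_dmx[f -> f1] u; rewrite /F11 !pevalM !pv_dmx.
rewrite -[RHS]mul1r -[1 in RHS](expr1n _ 3) -[in RHS]f1; ring.
Qed.

Lemma F00_slice (v : 'cV[F]_2) : peval F00 (slice v) = v 0 0 ^+ 2.
Proof. by rewrite /F00 !pevalM !pevalXU /slice !wedge_pl /=; ring. Qed.

Lemma F01_slice (v : 'cV[F]_2) : peval F01 (slice v) = v 0 0 * v 1 0.
Proof. by rewrite /F01 !pevalM !pevalXU /slice !wedge_pl /=; ring. Qed.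

Lemma F11_slice (v : 'cV[F]_2) : peval F11 (slice v) = v 1 0 ^+ 2.
Proof. by rewrite /F11 !pevalM !pevalXU /slice !wedge_pl /=; ring. Qed.

Lemma torus_invM p q : torus_inv p -> torus_inv q -> torus_inv (p * q).
Proof. by move=> pT qT t Tt u; rewrite !pevalM pT // qT. Qed.

Lemma torus_invX p k : torus_inv p -> torus_inv (p ^+ k).
Proof. by move=> pT t Tt u; rewrite !pevalXn pT. Qed.

Lemma half_parity (i j m : nat) : (i + j = m.*2)%N ->
  odd j = odd i /\ m = (i./2 + odd i + j./2)%N.
Proof.
move=> ijm; have oij : odd j = odd i.
  by have := congr1 odd ijm; rewrite oddD odd_double; case: odd; case: odd.
split=> //; apply: double_inj; rewrite -ijm !doubleD.
rewrite -{1}(odd_double_half i) -{1}(odd_double_half j) oij.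
by rewrite addnACA addnn addnA [((odd i).*2 + _)%N]addnC.
Qed.

(** The monomial with exponents i and j lifts to F00^(i / 2) F01^(i mod 2)
    F11^(j / 2). The last clause says that in positive degree these lifts lie in
    the ideal of F00, F01 and F11. *)
Lemma inv_lift m (p : {mpoly F[2]}) : hpoly m.*2 p -> exists P,
  [/\ hpoly (m * 7) P, torus_inv P,
      forall v : 'cV[F]_2, peval P (slice v) = peval p v &
      forall u, (0 < m)%N -> peval F00 u = 0 -> peval F01 u = 0 ->
        peval F11 u = 0 -> peval P u = 0].
Proof.
move=> hp; pose M (i j : nat) := F00 ^+ i./2 * F01 ^+ odd i * F11 ^+ j./2.
pose P := \sum_(mo <- msupp p) p@_mo *: M (mo ord0) (mo ord_max).
have deg mo : mo \in msupp p -> (mo ord0 + mo ord_max)%N = m.*2.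
  move=> /(dhomog_mf hp) /= <-; rewrite mdegE !big_ord_recl big_ord0 addn0.
  by congr (mo _ + mo _)%N; apply: val_inj.
exists P; split.
- rewrite /hpoly /= /P big_seq; apply: rpred_sum => mo /deg dm; apply: rpredZ.
  have [_ ->] := half_parity dm; rewrite mulnC !mulnDr.
  exact: (hpolyM (hpolyM (hpolyXn _ F00_hpoly) (hpolyXn _ F01_hpoly))
                 (hpolyXn _ F11_hpoly)).
- move=> t Tt u; rewrite !peval_sum; apply: eq_bigr => mo _.
  rewrite !pevalZ /M !pevalM !pevalXn.
  by rewrite F00_inv // F01_inv // F11_inv.
2: move=> u m0 u00 u01 u11; rewrite peval_sum big_seq big1 // => mo /deg dm.
2: have [_ mE] := half_parity dm; move: m0; rewrite mE.
2: rewrite pevalZ /M !pevalM !pevalXn u00 u01 u11.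
2: case: (half _) => [|i]; last by rewrite exprS !mul0r mulr0.
2: case: (odd _) => [|/=]; first by rewrite expr1 mulr0 !mul0r mulr0.
2: by case: (half _) => // i _; rewrite exprS mul0r !mulr0.
move=> v; rewrite peval_sum [in RHS]/peval mevalE big_seq [RHS]big_seq.
apply: eq_bigr => mo /deg dm; rewrite pevalZ; congr (_ * _).
rewrite /M !pevalM !pevalXn F00_slice F01_slice F11_slice.
rewrite !big_ord_recl big_ord0 mulr1.
have -> : lift ord0 ord0 = ord_max :> 'I_2 by apply: val_inj.
have -> : (1 : 'I_2) = ord_max by apply: val_inj.
have [od _] := half_parity dm; move: od.
move: (mo ord0) (mo ord_max) => i j od.
rewrite -[i in RHS]odd_double_half -[j in RHS]odd_double_half od.
rewrite !exprD -!mul2n !exprM.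
rewrite -[0 : 'I_2]/ord0; move: (v ord0 0) (v ord_max 0) => x y.
rewrite (exprMn _ x y).
by move: ((x ^+ 2) ^+ _) ((y ^+ 2) ^+ _) (x ^+ odd i) (y ^+ odd i) => *; ring.
Qed.

Lemma inv_ring_cut m f : inv_ring T rho X 7 m f -> exists P,
  [/\ hpoly (m * 7) P, torus_inv P, f = cut P &
      forall u, (0 < m)%N -> peval F00 u = 0 -> peval F01 u = 0 ->
        peval F11 u = 0 -> peval P u = 0].
Proof.
move=> hf; have [p hp fp] := inv_form hf.
have [P [hP PT Pp P0]] := inv_lift hp.
exists P; split=> //; apply: (inv_cut hf hP PT) => v v0.
by rewrite fp // Pp.
Qed.

Lemma inv_veronese : veronese (inv_ring T rho X 7) (@slice F).
Proof.
split=> [m f|m p hp|m f g hf hg fg|m c f g|k m f g].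
- exact: inv_form.
- have [P [hP PT Pp P0]] := inv_lift hp.
  exists (cut P); first exact: cut_inv.
  by move=> v v0; rewrite cutE ?Pp //; apply: slice_dom.
- have [p hp fp] := inv_form hf; have [P [hP PT Pp P0]] := inv_lift hp.
  rewrite (inv_cut hf hP PT); last by move=> v v0; rewrite fp // Pp.
  by rewrite (inv_cut hg hP PT) // => v v0; rewrite -fg // fp // Pp.
- move=> /inv_ring_cut[P [hP PT -> _]] /inv_ring_cut[Q [hQ QT -> _]].
  rewrite (_ : _ + _ = cut (c *: P + Q)).
    apply: cut_inv; first by apply: hpolyD => //; apply: hpolyZ.
    by move=> t Tt u; rewrite !pevalD !pevalZ PT // QT.
  apply: funext => u; rewrite [RHS]/cut.
  change (c * cut P u + cut Q u =
    if `[< dom (var X) <[u]>%VS >] then peval (c *: P + Q) u else 0).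
  rewrite /cut; case: ifP => _; first by rewrite pevalD pevalZ.
  by rewrite mulr0 addr0.
move=> /inv_ring_cut[P [hP PT -> _]] /inv_ring_cut[Q [hQ QT -> _]].
rewrite (_ : _ * _ = cut (P * Q)).
  apply: cut_inv; first by rewrite mulnDl; apply: hpolyM.
  exact: torus_invM.
apply: funext => u.
change (cut P u * cut Q u = cut (P * Q) u).
rewrite /cut; case: ifP => _; first by rewrite pevalM.
by rewrite mulr0.
Qed.

End Invariants.

(** * The quotient map and the descent of O(7) *)

Section Descent.
Variable F : closedFieldType.

Local Notation Lam := 'cV[F]_#|{: pidx 3 7}|.
Local Notation X := (richardson F (coset_rep s4s3) w37).
Local Notation T := (torus F 7).
Local Notation rho := (@ext_power F 3 7).
Local Notation S := (inv_ring T rho X 7).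
Local Notation SS := (ss_locus T rho X 7).
Local Notation Q := (GIT_quotient T rho X 7).
Local Notation q := (@quotient_map F 7 #|{: pidx 3 7}| T rho X 7).
Local Notation phi := (pointP (S := S) (@slice F)).
Implicit Types (u v : Lam) (l : {vspace Lam}).
Implicit Types (A B C : {mpoly F[#|{: pidx 3 7}|]}).

Let hv : veronese S (@slice F) := inv_veronese F.

Lemma inv_comp A B d (p : {mpoly F[2]}) : hpoly 7 A -> hpoly 7 B ->
  torus_inv A -> torus_inv B -> hpoly d p -> exists P,
  [/\ hpoly (d * 7) P, torus_inv P &
      forall u, peval P u = peval p (vec2 (peval A u) (peval B u))].
Proof.
move=> hA hB AT BT hp.
pose P := \sum_(mo <- msupp p) p@_mo *: (A ^+ mo ord0 * B ^+ mo ord_max).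
have PE u : peval P u = \sum_(mo <- msupp p)
    p@_mo * (peval A u ^+ mo ord0 * peval B u ^+ mo ord_max).
  by rewrite peval_sum; apply: eq_bigr => mo _; rewrite pevalZ pevalM !pevalXn.
exists P; split.
- rewrite /hpoly /= /P big_seq; apply: rpred_sum => mo mop; apply: rpredZ.
  have <- : (mo ord0 + mo ord_max)%N = d.
    rewrite -(dhomog_mf hp mop) /= mdegE !big_ord_recl big_ord0 addn0.
    by congr (mo _ + mo _)%N; apply: val_inj.
  rewrite mulnC mulnDr.
  exact: (hpolyM (hpolyXn _ hA) (hpolyXn _ hB)).
- by move=> t Tt u; rewrite !PE AT // BT.
move=> u; rewrite PE [RHS]/peval mevalE; apply: eq_bigr => mo _; congr (_ * _).
rewrite !big_ord_recl big_ord0 mulr1; congr (_ ^+ _ * _ ^+ _).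
- by rewrite vec2_0.
- by rewrite mxE.
by congr (mo _); apply: val_inj.
Qed.

(** With A, B, C the invariants F00, F01, F00 or F01, F11, F11, this tells where
    f vanishes from the vector (A u, B u) alone, wherever C does not vanish.
    Both sides are restrictions of invariants of the same degree, so that they
    need only be compared on the slice. *)
Lemma chart_eval A B C (i : 'I_2) m (f : Lam -> F^o) (p : {mpoly F[2]}) u :
  hpoly 7 A -> hpoly 7 B -> hpoly 7 C ->
  torus_inv A -> torus_inv B -> torus_inv C ->
  (forall v : 'cV[F]_2,
     vec2 (peval A (slice v)) (peval B (slice v)) = v i 0 *: v) ->
  (forall v : 'cV[F]_2, peval C (slice v) = v i 0 ^+ 2) ->
  S m f -> hpoly m.*2 p ->
  (forall v : 'cV[F]_2, v != 0 -> f (slice v) = peval p v) ->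
  dom (var X) <[u]>%VS ->
  f u * peval C u ^+ m = peval p (vec2 (peval A u) (peval B u)).
Proof.
move=> hA hB hC AT BT CT ABs Cs Sf hp fp du.
have [P [hP PT fE _]] := inv_ring_cut Sf.
have [G [hG GT GE]] := inv_comp hA hB AT BT hp.
have SG : S m.*2 (cut G) by apply: cut_inv.
have SPC : S m.*2 (cut (P * C ^+ m)).
  apply: cut_inv; last by apply: torus_invM => //; apply: torus_invX.
  rewrite -addnn mulnDl; apply: hpolyM => //; rewrite [(m * 7)%N]mulnC.
  exact: hpolyXn.
have E : cut (P * C ^+ m) = cut G.
  apply: (ver_inj hv SPC SG) => v v0.
  rewrite !cutE ?GE ?ABs; try exact: slice_dom.
  rewrite pevalM pevalXn Cs (peval_scale _ _ hp) -fp // fE cutE;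
    last exact: slice_dom.
  by rewrite mulrC -exprM mul2n.
have := congr1 (fun h => h u) E; rewrite !cutE // GE => <-.
by rewrite pevalM pevalXn fE cutE.
Qed.

Lemma chart0s (v : 'cV[F]_2) :
  vec2 (peval (F00 F) (slice v)) (peval (F01 F) (slice v)) = v 0 0 *: v.
Proof.
transitivity (v 0 0 *: vec2 (v 0 0) (v 1 0)); last by rewrite vec2K.
by rewrite F00_slice F01_slice vec2Z expr2.
Qed.

Lemma chart1s (v : 'cV[F]_2) :
  vec2 (peval (F01 F) (slice v)) (peval (F11 F) (slice v)) = v 1 0 *: v.
Proof.
transitivity (v 1 0 *: vec2 (v 0 0) (v 1 0)); last by rewrite vec2K.
by rewrite F01_slice F11_slice vec2Z expr2 mulrC.
Qed.

Lemma F01_sqr u : dom (var X) <[u]>%VS ->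
  peval (F01 F) u ^+ 2 = peval (F00 F) u * peval (F11 F) u.
Proof.
move=> du.
have S1 : S 2 (cut (F01 F ^+ 2)).
  apply: cut_inv; first exact: (hpolyXn 2 (F01_hpoly F)).
  exact/torus_invX/F01_inv.
have S2 : S 2 (cut (F00 F * F11 F)).
  apply: cut_inv; first exact: (hpolyM (F00_hpoly F) (F11_hpoly F)).
  by apply: torus_invM; [exact: F00_inv|exact: F11_inv].
have E : cut (F01 F ^+ 2) = cut (F00 F * F11 F).
  apply: (ver_inj hv S1 S2) => v _; rewrite !cutE; try exact: slice_dom.
  by rewrite pevalXn (pevalM (F00 F)) F00_slice F01_slice F11_slice exprMn.
by have := congr1 (fun h => h u) E; rewrite !cutE // pevalXn (pevalM (F00 F)).
Qed.

Lemma dom_line l u : dom (var X) l -> u \in l -> u != 0 ->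
  dom (var X) <[u]>%VS.
Proof. by move=> dl ul u0; rewrite -(line_ext dl.1 ul u0). Qed.

Lemma nonvanishing_cut k (p : {mpoly F[#|{: pidx 3 7}|]}) l :
  hpoly k p -> dom (var X) l ->
  (nonvanishing (cut p) l <-> nonvanishing (peval p) l).
Proof.
move=> hp dl; split=> [[v vl]|pl].
  rewrite /cut; case: asboolP => // dv pv; by exists v.
have [v v0 lE] := dim1_line dl.1.
have vl : v \in l by rewrite lE memv_line.
exists v => //; rewrite cutE; last exact: dom_line vl v0.
by apply/(nonvanishing_at hp dl.1 vl v0).
Qed.

(** All invariants of positive degree vanish where F00, F01 and F11 do, and F01
    vanishes where F00 and F11 do. *)
Lemma semistable_charts l u : semistable T rho X 7 l -> u \in l -> u != 0 ->
  peval (F00 F) u != 0 \/ peval (F11 F) u != 0.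
Proof.
move=> [dl [m [f [m0 Sf [v vl fv]]]]] ul u0.
have du := dom_line dl ul u0.
have [h0|] := eqVneq (peval (F00 F) u) 0; last by left.
have [h1|] := eqVneq (peval (F11 F) u) 0; last by right.
have h01 : peval (F01 F) u = 0.
  by apply/eqP; rewrite -sqrf_eq0 F01_sqr // h0 mul0r.
have [P [hP PT fE P0]] := inv_ring_cut Sf.
have : nonvanishing (peval P) l.
  by apply/(nonvanishing_cut hP dl); exists v; rewrite -?fE.
by move=> /(nonvanishing_at hP dl.1 ul u0); rewrite P0.
Qed.

Lemma quotient_pid A B C (i : 'I_2) l u :
  hpoly 7 A -> hpoly 7 B -> hpoly 7 C ->
  torus_inv A -> torus_inv B -> torus_inv C ->
  (forall v : 'cV[F]_2,
     vec2 (peval A (slice v)) (peval B (slice v)) = v i 0 *: v) ->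
  (forall v : 'cV[F]_2, peval C (slice v) = v i 0 ^+ 2) ->
  dom (var X) l -> u \in l -> u != 0 -> peval C u != 0 ->
  vec2 (peval A u) (peval B u) != 0 ->
  q l = pid S (@slice F) (vec2 (peval A u) (peval B u)).
Proof.
move=> hA hB hC AT BT CT ABs Cs dl ul u0 Cu w0.
have du := dom_line dl ul u0.
have key m f : S m f -> (nonvanishing f l <->
    f (slice (vec2 (peval A u) (peval B u))) <> 0).
  move=> Sf; have [p hp fp] := ver_form hv Sf.
  rewrite fp // -(chart_eval hA hB hC AT BT CT ABs Cs Sf hp fp du).
  have [P [hP PT fE _]] := inv_ring_cut Sf.
  rewrite fE (nonvanishing_cut hP dl) (nonvanishing_at hP dl.1 ul u0) cutE //.
  split=> [/eqP pu|pu pu0]; last by apply: pu; rewrite pu0 mul0r.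
  by apply/eqP; rewrite mulf_neq0 // expf_neq0.
apply: funext => m; apply/seteqP; split=> f [Sf nf]; split=> //.
  by apply: contrapT => /(key _ _ Sf).
by move=> /(key _ _ Sf); rewrite nf.
Qed.

Lemma quotient_chart0 l u : dom (var X) l -> u \in l -> u != 0 ->
  peval (F00 F) u != 0 ->
  q l = pid S (@slice F) (vec2 (peval (F00 F) u) (peval (F01 F) u)).
Proof.
move=> dl ul u0 Cu.
apply: (quotient_pid (F00_hpoly F) (F01_hpoly F) (F00_hpoly F)
  (@F00_inv F) (@F01_inv F) (@F00_inv F) chart0s (@F00_slice F)) => //.
by rewrite vec2_eq0 vec2_0 (negbTE Cu).
Qed.

Lemma quotient_chart1 l u : dom (var X) l -> u \in l -> u != 0 ->
  peval (F11 F) u != 0 ->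
  q l = pid S (@slice F) (vec2 (peval (F01 F) u) (peval (F11 F) u)).
Proof.
move=> dl ul u0 Cu.
apply: (quotient_pid (F01_hpoly F) (F11_hpoly F) (F11_hpoly F)
  (@F01_inv F) (@F11_inv F) (@F11_inv F) chart1s (@F11_slice F)) => //.
by rewrite vec2_eq0 vec2_1 (negbTE Cu) andbF.
Qed.

Lemma phi_chart0 l u : dom (var X) l -> u \in l -> u != 0 ->
  peval (F00 F) u != 0 ->
  phi (q l) = <[vec2 (peval (F00 F) u) (peval (F01 F) u)]>%VS.
Proof.
move=> dl ul u0 Cu; rewrite (quotient_chart0 dl ul u0 Cu).
by rewrite (pointP_pid hv) // vec2_eq0 vec2_0 (negbTE Cu).
Qed.

Lemma phi_chart1 l u : dom (var X) l -> u \in l -> u != 0 ->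
  peval (F11 F) u != 0 ->
  phi (q l) = <[vec2 (peval (F01 F) u) (peval (F11 F) u)]>%VS.
Proof.
move=> dl ul u0 Cu; rewrite (quotient_chart1 dl ul u0 Cu).
by rewrite (pointP_pid hv) // vec2_eq0 vec2_1 (negbTE Cu) andbF.
Qed.

Lemma ringedQ : ringed Q. Proof. exact: Proj_ringed hv. Qed.

Lemma ringedSS : ringed SS.
Proof. exact/subspace_ringed/proj_space_ringed. Qed.

Lemma quotient_closed l : semistable T rho X 7 l -> closed_point S (q l).
Proof.
move=> ssl; have [dl _] := ssl; have [u u0 lE] := dim1_line dl.1.
have ul : u \in l by rewrite lE memv_line.
have [Cu|Cu] := semistable_charts ssl ul u0.
  rewrite (quotient_chart0 dl ul u0 Cu); apply: (pid_closed hv).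
  by rewrite vec2_eq0 vec2_0 (negbTE Cu).
rewrite (quotient_chart1 dl ul u0 Cu); apply: (pid_closed hv).
by rewrite vec2_eq0 vec2_1 (negbTE Cu) andbF.
Qed.

Lemma quotient_map_regular : regular_map SS Q q.
Proof.
split=> [l [dl1 ssl]|W oW|W h oW rh l [[dl1 ssl] Wl]].
- exact: quotient_closed.
- exists [set l | \dim l = 1%N /\ exists m P,
      [/\ hpoly (m * 7) P, nonvanishing (peval P) l &
        forall l', semistable T rho X 7 l' -> nonvanishing (peval P) l' ->
          W (q l')]].
    move=> l [dl [m [P [hP Pl PW]]]]; split=> //.
    exists (m * 7)%N, P; split=> //.
    by move=> l' dl' Pl'; split=> //; exists m, P.
  apply/seteqP; split=> l /=; last first.
    move=> [[dl [m [P [hP Pl PW]]]] ssl].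
    by split; [split|exact: PW].
  move=> [[dl1 ssl] Wl]; split=> //; split=> //.
  have [cl [m [f [m0 Sf nf fW]]]] := oW _ Wl.
  have [P [hP PT fE _]] := inv_ring_cut Sf; have [dl _] := ssl.
  exists m, P; split=> //.
    apply/(nonvanishing_cut hP dl); rewrite -fE.
    by apply: contrapT => nv; apply: nf.
  move=> l' ssl' Pl'; have [dl' _] := ssl'.
  apply: fW; first exact: quotient_closed.
  by move=> [_]; apply; rewrite fE; apply/(nonvanishing_cut hP dl').
have [dl _] := ssl.
have [m [a [b [Sa Sb nb ab]]]] := rh _ Wl.
have [Pa [hPa PaT aE _]] := inv_ring_cut Sa.
have [Pb [hPb PbT bE _]] := inv_ring_cut Sb.
have Pbl : nonvanishing (peval Pb) l.
  apply/(nonvanishing_cut hPb dl); rewrite -bE.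
  by apply: contrapT => nv; apply: nb.
exists (pdomain Pb), (fun l' => peval Pa (vpick l') / peval Pb (vpick l')).
split=> //.
- exact: pdomain_open hPb.
- move=> l1 [dl1' Pbl1]; exists (m * 7)%N, Pa, Pb.
  split=> // l' v [dl' Pl'] _ vl' /eqP v0.
  have p0 : vpick l' != 0 by rewrite vpick0 -dimv_eq0 dl'.
  have [c c0 ->] := line_mem_neq0 dl' (memv_pick l') p0 vl' v0.
  rewrite (peval_scale _ _ hPa) (peval_scale _ _ hPb).
  by rewrite -mulf_div divff ?mul1r // expf_neq0.
move=> l' [dl1' Pbl'] [[_ ssl'] Wl']; have [dl' _] := ssl'.
have p0 : vpick l' != 0 by rewrite vpick0 -dimv_eq0 dl1'.
have dp := dom_line dl' (memv_pick l') p0.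
have /(nonvanishing_at hPb dl1' (memv_pick l') p0)/eqP bp := Pbl'.
have [|_ nv] := ab _ Wl'.
  by move=> [_]; apply; rewrite bE; apply/(nonvanishing_cut hPb dl').
have /eqP : a (vpick l') - h (q l') * b (vpick l') = 0.
  apply: contrapT => ne; apply: nv; exists (vpick l'); first exact: memv_pick.
  exact: ne.
by rewrite aE bE !cutE // subr_eq0 => /eqP ->; rewrite /= mulfK.
Qed.

Local Notation N := (pullback Q (proj_space F 2) phi (O_ F 2 2)).

(** A form g of degree 2 on the line phi (q l) is evaluated at the vector (F00
    u, F01 u) or (F01 u, F11 u) of that line. Division by F00 u or F11 u makes
    the result homogeneous of degree 7 in u and independent of the choice. *)
Definition theta l (g : 'cV[F]_2 -> F^o) : Lam -> F^o := fun u =>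
  if (u \in l) && (u != 0) then
    if peval (F00 F) u != 0
    then g (vec2 (peval (F00 F) u) (peval (F01 F) u)) / peval (F00 F) u
    else g (vec2 (peval (F01 F) u) (peval (F11 F) u)) / peval (F11 F) u
  else 0.

Lemma theta_equivariant t l g : T t ->
  theta (act_line rho t l) g = act_fib rho t (theta l g).
Proof.
move=> Tt; apply: funext => u; rewrite /theta /act_fib mem_act_line //.
have Tt' := torusV Tt.
by rewrite (rho_eq0 _ Tt') (F00_inv Tt') (F01_inv Tt') (F11_inv Tt').
Qed.

Lemma O2_frame (i : 'I_2) :
  frame (L := O_ F 2 2) (pdomain ('X_i ^+ 2)) (psec ('X_i ^+ 2)).
Proof. exact: (O_frame (hpolyXn 2 (hpolyXU F i))). Qed.

Lemma N_frame (i : 'I_2) : frame (L := N)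
  (dom Q `&` phi @^-1` pdomain ('X_i ^+ 2)) (psec ('X_i ^+ 2) \o phi).
Proof.
exact: (frame_pullback ringedQ (proj_space_ringed F 2) (@O_res F 2 2)
  (pointP_regular hv) (O2_frame i)).
Qed.

Lemma N_line_bundle : is_line_bundle N.
Proof.
apply: line_bundle_frames; first exact: pullback_local.
move=> P dP; have dl := pointP_dim hv dP.
have [w w0 lE] := dim1_line dl.
have [i wi] : exists i : 'I_2, w i 0 != 0.
  by move: w0; rewrite vec2_eq0 negb_and => /orP[]; [exists 0|exists 1].
exists (dom Q `&` phi @^-1` pdomain ('X_i ^+ 2)), (psec ('X_i ^+ 2) \o phi).
split; last exact: N_frame.
split=> //; split=> //; rewrite lE.
apply/(nonvanishing_line (hpolyXn 2 (hpolyXU F i)) w0).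
by rewrite pevalXn pevalXU; apply/eqP; rewrite expf_neq0.
Qed.

Lemma frame_res (Y : fspace F) (L : bundle Y) U W e : is_open Y W -> W `<=` U ->
  frame (L := L) U e -> frame (L := L) W e.
Proof.
move=> oW WU [oU eU sU]; split=> // [y /WU /eU //|W' s oW' W'W].
by apply: sU => // y /W'W /WU.
Qed.

(** The frame of O(2) given by the square of the i-th coordinate corresponds to
    the frame of O(7) given by C, where C is F00 for i = 0 and F11 for i = 1. *)
Lemma theta_iso : @bundle_iso F SS (pullback SS Q q N)
  (O_on (semistable T rho X 7) 7) theta.
Proof.
apply: frames_iso; [exact: ringedSS|exact: pullback_local
  |exact: (pullback_res ringedSS)|exact: pullback_local
  |exact: (pullback_res ringedSS)|].
move=> l [dl1 ssl]; have [dl _] := ssl.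
have [u u0 lE] := dim1_line dl1.
have ul : u \in l by rewrite lE memv_line.
have main (i : 'I_2) C : hpoly 7 C -> peval C u != 0 ->
    (forall l', semistable T rho X 7 l' -> forall v, v \in l' -> v != 0 ->
       peval C v != 0 -> exists w : 'cV[F]_2,
       [/\ w != 0, phi (q l') = <[w]>%VS, w i 0 != 0 &
        forall g, theta l' g v = g w * peval C v / w i 0 ^+ 2]) ->
    exists U e f, [/\ U l, frame (L := pullback SS Q q N) U e,
      frame (L := O_on (semistable T rho X 7) 7) U f &
      forall y c, U y -> theta y (c *: e y : 'cV[F]_2 -> F^o) = c *: f y].
  move=> hC Cu hw.
  have fr1 := frame_pullback ringedSS ringedQ (pullback_res ringedQ)
    quotient_map_regular (N_frame i).
  have fr2 := O_on_frame (semistable T rho X 7) hC.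
  set U1 := dom SS `&` _ in fr1; set U2 := _ `&` pdomain C in fr2.
  have o12 : is_open SS (U1 `&` U2).
    by apply: (openI ringedSS); [case: fr1|case: fr2].
  exists (U1 `&` U2), (psec ('X_i ^+ 2) \o phi \o q), (psec C); split.
  - have [w [w0 pw wi _]] := hw l ssl u ul u0 Cu.
    split; last first.
      by split=> //; split=> //; apply/(nonvanishing_at hC dl1 ul u0)/eqP.
    split=> //; split; first by have [+ _ _] := quotient_map_regular; apply.
    rewrite /preimage /= pw; split; first exact: dim_line.
    apply/(nonvanishing_line (hpolyXn 2 (hpolyXU F i)) w0).
    by rewrite pevalXn pevalXU; apply/eqP; rewrite expf_neq0.
  - exact: (frame_res o12 (@subIsetl _ _ _) fr1).
  - exact: (frame_res o12 (@subIsetr _ _ _) fr2).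
  move=> l' c [_ [[dl1' ssl'] [_ Cl']]]; apply: funext => v.
  change (theta l' (c *: psec ('X_i ^+ 2) (phi (q l'))) v = c * psec C l' v).
  have [/andP[vl v0]|vn] := boolP ((v \in l') && (v != 0)); last first.
    by rewrite /theta /psec (negbTE vn) mulr0.
  have /(nonvanishing_at hC dl1' vl v0)/eqP Cv := Cl'.
  have [w [w0 pw wi ->]] := hw l' ssl' v vl v0 Cv.
  change (c * psec ('X_i ^+ 2) (phi (q l')) w * peval C v / w i 0 ^+ 2 =
    c * psec C l' v).
  rewrite /psec pw memv_line w0 vl v0 pevalXn pevalXU /=.
  by field.
have [Cu|Cu] := semistable_charts ssl ul u0.
  apply: (main 0 (F00 F) (F00_hpoly F) Cu) => l' ssl' v vl v0 Cv.
  have [dl' _] := ssl'.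
  exists (vec2 (peval (F00 F) v) (peval (F01 F) v)); split.
  - by rewrite vec2_eq0 vec2_0 (negbTE Cv).
  - exact: phi_chart0.
  - by rewrite vec2_0.
  by move=> g; rewrite /theta vl v0 Cv vec2_0 /=; field.
apply: (main 1 (F11 F) (F11_hpoly F) Cu) => l' ssl' v vl v0 Cv.
have [dl' _] := ssl'.
have [C0|C0] := eqVneq (peval (F00 F) v) 0.
  exists (vec2 (peval (F01 F) v) (peval (F11 F) v)); split.
  - by rewrite vec2_eq0 vec2_1 (negbTE Cv) andbF.
  - exact: phi_chart1.
  - by rewrite vec2_1.
  by move=> g; rewrite /theta vl v0 C0 eqxx vec2_1 /=; field.
have sq := F01_sqr (dom_line dl' vl v0).
have F010 : peval (F01 F) v != 0 by rewrite -sqrf_eq0 sq mulf_neq0.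
exists (vec2 (peval (F00 F) v) (peval (F01 F) v)); split.
- by rewrite vec2_eq0 vec2_0 (negbTE C0).
- exact: phi_chart0.
- by rewrite vec2_1.
by move=> g; rewrite /theta vl v0 C0 vec2_1 /= sq; field; rewrite C0 Cv.
Qed.

Theorem richardson_quotient :
  biregular Q (proj_space F 2) phi /\ is_GIT_descent T rho X 7 N.
Proof.
split; first exact: pointP_biregular hv.
split; first exact: N_line_bundle.
exists theta; first exact: theta_iso.
by move=> t l g Tt _ _; apply: theta_equivariant.
Qed.

End Descent.

Theorem lemma5p11 (R : realType) :
  let T := torus R[i] 7 in
  let X := richardson R[i] (coset_rep s4s3) w37 in
  let Q : fspace R[i] := GIT_quotient T (ext_power 3) X 7 in
  let P1 : fspace R[i] := proj_space R[i] 2 in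
  exists2 phi : pt Q -> pt P1,
    biregular Q P1 phi &
    is_GIT_descent T (ext_power 3) X 7 (pullback Q P1 phi (O_ R[i] 2 2)).
Proof.
have [bi de] := richardson_quotient R[i].
by exists (pointP (S := inv_ring (torus R[i] 7) (@ext_power R[i] 3 7)
  (richardson R[i] (coset_rep s4s3) w37) 7) (@slice R[i])).
Qed.
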